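(* Let $\mathbb{A}$ be as below, $\mathbb{F}$ a field and $d\ge1$. There exists a finite family of $\operatorname{Aut}(\mathbb{A})$-equivariant linear maps $\restriction_i:\operatorname{Lin}_{\mathbb{F}}\mathbb{A}^d\to\operatorname{Lin}_{\mathbb{F}^{n_i}}\mathcal{O}_i$, where each $\mathcal{O}_i$ is an ordered $\operatorname{Aut}(\mathbb{A})$-orbit in $\mathbb{A}^{d_i}$ with $d_i\le d$ and $n_i\ge1$, such that every $\operatorname{Aut}(\mathbb{A})$-invariant subspace $W\subseteq\operatorname{Lin}_{\mathbb{F}}\mathbb{A}^d$ satisfies $W=\{v\in\operatorname{Lin}_{\mathbb{F}}\mathbb{A}^d \mid \forall i,\ \forall a\in\mathcal{O}_i:\ (v\restriction_i)(a)\in\mathbb{E}_i\}$, where $\mathbb{E}_i=\{(w\restriction_i)(b)\mid w\in W,\ b\in\mathcal{O}_i\}$ is a subspace of $\mathbb{F}^{n_i}$.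
   Context: $\mathbb{A}$ is the Fraïssé limit of the class of all totally ordered (new symbol $<$) members of a free amalgamation class $\mathscr{C}_0=\operatorname{Forb}(\mathscr{F})$ of finite irreflexive $\sigma_0$-structures, $\sigma_0$ a finite vocabulary of unary and binary relations (in each member of $\mathscr{F}$ any two elements $u,v$ are related: $u=v$ or $R(u,v)$ or $R(v,u)$ for some binary $R$; irreflexive: binary relations hold only between distinct elements). An ordered orbit in $\mathbb{A}^{k}$ is an $\operatorname{Aut}(\mathbb{A})$-orbit of a tuple $(a_1,\dots,a_k)$ with $a_1<\dots<a_k$. $\operatorname{Lin}_{\mathbb{F}}X$ is the space of finite formal $\mathbb{F}$-linear combinations of elements of $X$, and $\operatorname{Lin}_{\mathbb{F}^{n}}\mathcal{O}$ the space of finitely supported functions $\mathcal{O}\to\mathbb{F}^n$; $\operatorname{Aut}(\mathbb{A})$ acts on these through its componentwise action on tuples. For $u$ in such a space, $u(a)$ denotes its coefficient at $a$. *)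

(* Defs.v *)
From mathcomp Require Import all_boot all_algebra.
Set Implicit Arguments. Unset Strict Implicit. Unset Printing Implicit Defensive.
Import GRing.Theory.
Local Open Scope ring_scope.

(** Vocabulary sigma_0: finite types [U] of unary and [B] of binary relation
    symbols.  A sigma_0-structure on a carrier X is given by
    [un : X -> U -> bool] and [bin : X -> X -> B -> bool]. *)

Section Defs.
Variables (U B : finType).

Record fstr := FStr {
  fsz : nat;
  fun1 : 'I_fsz -> U -> bool;
  fbin : 'I_fsz -> 'I_fsz -> B -> bool }.
Arguments fun1 : clear implicits.
Arguments fbin : clear implicits.

Definition irreducible (S : fstr) : Prop :=
  forall x y : 'I_(fsz S), x != y -> exists b : B, fbin S x y b || fbin S y x b.

Definition embeds (S : fstr) (X : Type) (un : X -> U -> bool)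
    (bin : X -> X -> B -> bool) : Prop :=
  exists f : 'I_(fsz S) -> X, injective f /\
    (forall x u, un (f x) u = fun1 S x u) /\
    (forall x y b, bin (f x) (f y) b = fbin S x y b).

Definition forb (Fam : fstr -> Prop) (X : Type) (un : X -> U -> bool)
    (bin : X -> X -> B -> bool) : Prop :=
  forall S, Fam S -> ~ embeds S un bin.

Definition irrefl_bin (X : Type) (bin : X -> X -> B -> bool) : Prop :=
  forall x b, bin x x b = false.

Definition strict_total (X : eqType) (lt : rel X) : Prop :=
  irreflexive lt /\ transitive lt /\ (forall x y, x != y -> lt x y || lt y x).

Variables (T : countType) (un : T -> U -> bool) (bin : T -> T -> B -> bool)
  (lt : rel T).

Definition isAut (g h : T -> T) : Prop :=
  cancel g h /\ cancel h g /\
  (forall x u, un (g x) u = un x u) /\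
  (forall x y b, bin (g x) (g y) b = bin x y b) /\
  (forall x y, lt (g x) (g y) = lt x y).

(** (T, un, bin, lt) is the Fraisse limit of the class of all totally ordered
    members of the class C0 = Forb(Fam) of finite irreflexive sigma_0-structures:
    T is countable (countType), its age is exactly that class, and it is
    ultrahomogeneous. *)
Definition fraisse_limit (Fam : fstr -> Prop) : Prop :=
  (* age contained in the class *)
  strict_total lt /\ irrefl_bin bin /\ forb Fam un bin /\
  (forall (n : nat) (un' : 'I_n -> U -> bool) (bin' : 'I_n -> 'I_n -> B -> bool)
      (lt' : rel 'I_n),
     strict_total lt' -> irrefl_bin bin' -> forb Fam un' bin' ->
     exists f : 'I_n -> T, injective f /\
       (forall x u, un (f x) u = un' x u) /\
       (forall x y b, bin (f x) (f y) b = bin' x y b) /\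
       (forall x y, lt (f x) (f y) = lt' x y)) /\
  (forall (n : nat) (x y : 'I_n -> T), injective x -> injective y ->
     (forall i u, un (y i) u = un (x i) u) ->
     (forall i j b, bin (y i) (y j) b = bin (x i) (x j) b) ->
     (forall i j, lt (y i) (y j) = lt (x i) (x j)) ->
     exists g h, isAut g h /\ forall i, g (x i) = y i).

Definition in_aut_orbit (k : nat) (a b : k.-tuple T) : Prop :=
  exists g h, isAut g h /\ b = map_tuple g a.

(** [a] is strictly increasing, so its orbit is an ordered orbit. *)
Definition increasing (k : nat) (a : k.-tuple T) : Prop := sorted lt a.

(** Finitely supported functions: elements of Lin_V X. *)
Definition finsupp (X : eqType) (V : nmodType) (v : X -> V) : Prop :=
  exists s : seq X, forall x, v x != 0 -> x \in s.

Variable (F : fieldType).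

(** [rho] is an Aut-equivariant linear map
    Lin_F T^d -> Lin_{F^n} O, where O is the orbit of [a]. Elements of
    Lin_{F^n} O are represented as finitely supported functions on k-tuples
    vanishing outside O.  The action of an automorphism g (inverse h) on a
    function v is (g.v)(c) = v(h c). *)
Definition equiv_linear (d k n : nat) (a : k.-tuple T)
    (rho : (d.-tuple T -> F) -> (k.-tuple T -> 'rV[F]_n)) : Prop :=
  (forall v, finsupp v -> finsupp (rho v) /\
     (forall b, ~ in_aut_orbit a b -> rho v b = 0)) /\
  (forall v w, finsupp v -> finsupp w ->
     forall b, rho (fun c => v c + w c) b = rho v b + rho w b) /\
  (forall (x : F) v, finsupp v -> forall b, rho (fun c => x * v c) b = x *: rho v b) /\
  (forall g h, isAut g h -> forall v, finsupp v ->
     forall b, rho (fun c => v (map_tuple h c)) b = rho v (map_tuple h b)).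

Definition inv_subspace (d : nat) (W : (d.-tuple T -> F) -> Prop) : Prop :=
  (forall v, W v -> finsupp v) /\
  W (fun _ => 0) /\
  (forall v w, W v -> W w -> W (fun c => v c + w c)) /\
  (forall (x : F) v, W v -> W (fun c => x * v c)) /\
  (forall g h, isAut g h -> forall v, W v -> W (fun c => v (map_tuple h c))).

Definition Eset (d k n : nat) (W : (d.-tuple T -> F) -> Prop) (a : k.-tuple T)
    (rho : (d.-tuple T -> F) -> (k.-tuple T -> 'rV[F]_n)) (e : 'rV[F]_n) : Prop :=
  exists w b, W w /\ in_aut_orbit a b /\ rho w b = e.

Definition is_subspace (n : nat) (E : 'rV[F]_n -> Prop) : Prop :=
  E 0 /\ (forall e f, E e -> E f -> E (e + f)) /\ (forall (x : F) e, E e -> E (x *: e)).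

End Defs.

(* Main.v *)
Require Import Defs.
From mathcomp Require Import all_boot all_algebra zify ring.
From Stdlib Require Import ClassicalEpsilon FunctionalExtensionality.
Set Implicit Arguments. Unset Strict Implicit. Unset Printing Implicit Defensive.
Import GRing.Theory.

(** For increasing k-tuples b, let [restr v b] collect, over all quantifier-free
    types t of d-tuples and all maps f : k -> d, the sums of the coefficients v(c)
    over the tuples c of type t with c o f = b; the maps of the theorem are the
    restrictions of [restr v] to the finitely many ordered orbits of length at
    most d.  Suppose that all values of v are values of W, and subtract elements of
    W level by level, assuming [restr v] = 0 at all lengths below l.  On an ordered
    orbit O of length l the function u = [restr v] then has zero sum along every
    coordinate direction.
    - Such a u is a combination of cubes, i.e. alternating sums over the 2^l
      tuples obtained from some a in O by replacing some a_i by unrelated a'_i, with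
      coefficients among the values of u ([span_cubes]).
    - If e = [restr w b0] with w in W, then e times any cube is at level l the
      [restr] of an element of W that vanishes on the other orbits of length at
      most l: apply to w the alternating sum of automorphisms moving some of the
      points of b0 and fixing the rest of the support ([cube_in_subspace]).
    Hence u comes from W, and at the end [restr] vanishes at all lengths up to d,
    which forces v - w = 0.
    Free amalgamation enters through the finite extensions of finite subsets of
    the limit: in them two elements are unrelated unless both lie in an embedded
    part, so a forbidden irreducible structure would already embed in the limit. *)

(** * Finite extensions inside the Fraïssé limit *)

Section Extension.
Variables (U B : finType) (Fam : fstr U B -> Prop).
Variables (T : countType) (un : T -> U -> bool) (bin : T -> T -> B -> bool)
  (lt : rel T).
Hypothesis irrFam : forall S, Fam S -> irreducible S.
Hypothesis limT : fraisse_limit un bin lt Fam.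

Lemma ltxx x : lt x x = false.
Proof. by case: limT => [[H _] _]; apply: H. Qed.

Lemma lt_trans : transitive lt.
Proof. by case: limT => [[_ [H _]] _]. Qed.

Lemma lt_total x y : x != y -> lt x y || lt y x.
Proof. by case: limT => [[_ [_ H]] _]; apply: H. Qed.

Lemma lt_asym x y : lt x y -> lt y x = false.
Proof.
by move=> xy; apply/negP => yx; have := lt_trans xy yx; rewrite ltxx.
Qed.

Lemma bin_irrefl x b : bin x x b = false.
Proof. by case: limT => [_ [H _]]; apply: H. Qed.

Lemma forbT : forb Fam un bin.
Proof. by case: limT => [_ [_ [H _]]]. Qed.

Lemma homogeneous (n : nat) (x y : 'I_n -> T) : injective x ->
    (forall i u, un (y i) u = un (x i) u) ->
    (forall i j b, bin (y i) (y j) b = bin (x i) (x j) b) ->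
    (forall i j, lt (y i) (y j) = lt (x i) (x j)) ->
  exists g h, isAut un bin lt g h /\ forall i, g (x i) = y i.
Proof.
move=> injx Hu Hb Hl; case: limT => [_ [_ [_ [_ H]]]]; apply: H => //.
(* Injectivity of [y]: distinct points of [x] are comparable, and [y] has the same order pattern as
   [x]. *)
move=> i j eij; apply: injx; apply/eqP; apply: contraTT isT => nij.
have := lt_total nij; rewrite -!Hl eij ltxx; done.
Qed.

Lemma homogeneous_fin (N : finType) (x y : N -> T) : injective x ->
    (forall i u, un (y i) u = un (x i) u) ->
    (forall i j b, bin (y i) (y j) b = bin (x i) (x j) b) ->
    (forall i j, lt (y i) (y j) = lt (x i) (x j)) ->
  exists g h, isAut un bin lt g h /\ forall i, g (x i) = y i.
Proof.
move=> injx Hu Hb Hl.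
have [||||g [h [aut e]]] := @homogeneous #|{: N}| (x \o enum_val) (y \o enum_val).
- exact: inj_comp injx enum_val_inj.
- by move=> i u; apply: Hu.
- by move=> i j b; apply: Hb.
- by move=> i j; apply: Hl.
by exists g, h; split=> // i; have := e (enum_rank i); rewrite /= enum_rankK.
Qed.

Lemma strict_total_key (N : eqType) (key : N -> nat) :
  injective key -> strict_total (fun n m => key n < key m).
Proof.
move=> inj; split; first by move=> x; rewrite ltnn.
split; first by move=> x y z; apply: ltn_trans.
move=> x y; rewrite -neq_ltn; apply: contra_neq; exact: inj.
Qed.

(** Irreducibility makes every two distinct vertices of [S] related, so [q] only has to respect
    related pairs. It cannot identify two of them, since the limit is irreflexive. *)
Lemma embeds_fold (S : fstr U B) (N : Type) (un' : N -> U -> bool)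
    (bin' : N -> N -> B -> bool) (f : 'I_(fsz S) -> N) (q : N -> T) :
  irreducible S -> irrefl_bin bin' ->
  (forall x u, un' (f x) u = @fun1 U B S x u) ->
  (forall x y b, bin' (f x) (f y) b = @fbin U B S x y b) ->
  (forall x u, un (q (f x)) u = un' (f x) u) ->
  (forall x y b, x != y -> bin' (f x) (f y) b || bin' (f y) (f x) b ->
     forall b', bin (q (f x)) (q (f y)) b' = bin' (f x) (f y) b') ->
  embeds S un bin.
Proof.
move=> irrS irr' Hu Hb qu qb; exists (q \o f).
have qb' x y : x != y -> forall b', bin (q (f x)) (q (f y)) b' = bin' (f x) (f y) b'.
  by move=> nxy; have [b] := irrS x y nxy; rewrite -!Hb; apply: qb.
split; last split.
- move=> x y /= eqf; apply/eqP/idPn => nxy.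
  have nyx : y != x by rewrite eq_sym.
  have [b] := irrS x y nxy; rewrite -!Hb -(qb' _ _ nxy) -(qb' _ _ nyx).
  by rewrite eqf bin_irrefl.
- by move=> x u /=; rewrite qu Hu.
- move=> x y b /=; have [->|nxy] := eqVneq x y; last by rewrite qb' // Hb.
  by rewrite bin_irrefl -Hb irr'.
Qed.

(** The age provides a copy of the structure somewhere in the limit; homogeneity then moves its part
    over [Z] back onto [Z]. *)
Lemma extension (Z : seq T) (X : finType)
    (un' : seq_sub Z + X -> U -> bool)
    (bin' : seq_sub Z + X -> seq_sub Z + X -> B -> bool)
    (lt' : rel (seq_sub Z + X)%type) :
  strict_total lt' -> irrefl_bin bin' -> forb Fam un' bin' ->
  (forall z u, un' (inl z) u = un (val z) u) ->
  (forall z y b, bin' (inl z) (inl y) b = bin (val z) (val y) b) ->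
  (forall z y, lt' (inl z) (inl y) = lt (val z) (val y)) ->
  exists e : seq_sub Z + X -> T, [/\ forall z, e (inl z) = val z, injective e,
    forall n u, un (e n) u = un' n u,
    forall n m b, bin (e n) (e m) b = bin' n m b &
    forall n m, lt (e n) (e m) = lt' n m].
Proof.
move=> [lt1 [lt2 lt3]] irr' forb' Hu Hb Hl.
pose N := (seq_sub Z + X)%type.
case: limT => [_ [_ [_ [age _]]]].
have [] := age #|{: N}| (fun i => un' (enum_val i))
  (fun i j => bin' (enum_val i) (enum_val j))
  (fun i j => lt' (enum_val i) (enum_val j)).
- split; first by move=> x; apply: lt1.
  split; first by move=> x y z; apply: lt2.
  by move=> x y nxy; apply: lt3; rewrite (inj_eq enum_val_inj).
- by move=> x b; apply: irr'.
- move=> S FS [f [injf [fu fb]]]; apply: (forb' _ FS).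
  exists (fun x => enum_val (f x)); split; first by move=> x y /enum_val_inj /injf.
  by split.
move=> f [injf [fu [fb fl]]].
pose e0 (n : N) := f (enum_rank n).
have e0u n u : un (e0 n) u = un' n u by rewrite fu enum_rankK.
have e0b n m b : bin (e0 n) (e0 m) b = bin' n m b by rewrite fb !enum_rankK.
have e0l n m : lt (e0 n) (e0 m) = lt' n m by rewrite fl !enum_rankK.
have e0i : injective e0 by move=> n m /injf /enum_rank_inj.
have [] := @homogeneous_fin (seq_sub Z) (fun z => e0 (inl z)) val.
- by move=> i j /e0i [].
- by move=> i u; rewrite e0u Hu.
- by move=> i j b; rewrite e0b Hb.
- by move=> i j; rewrite e0l Hl.
move=> g [h [[gh [hg [gu [gb gl]]]] Hg]].
exists (g \o e0); split.
- by [].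
- exact: inj_comp (can_inj gh) e0i.
- by move=> n u /=; rewrite gu e0u.
- by move=> n m b /=; rewrite gb e0b.
- by move=> n m /=; rewrite gl e0l.
Qed.

End Extension.

(** * Counting, lexicographic order and quantifier-free types *)

Lemma count_ltn (A : eqType) (p q : pred A) (s : seq A) z :
  subpred p q -> z \in s -> q z -> ~~ p z -> count p s < count q s.
Proof.
move=> pq; elim: s => // y s IHs; rewrite inE => /orP[/eqP <-|zs] qz pz /=.
  by rewrite qz (negPf pz) add0n add1n ltnS sub_count.
have := IHs zs qz pz; have := pq y.
by case: (p y) => [/(_ isT) ->|_]; [lia|case: (q y); lia].
Qed.

Lemma ltn_lex M x x' y y' : x' < M -> y' < M ->
  (x * M + x' < y * M + y') = (x < y) || ((x == y) && (x' < y')).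
Proof. by move=> xM yM; case: (ltngtP x y) => //= xy; nia. Qed.

Section Types.
Variables (U B : finType) (T : countType) (un : T -> U -> bool)
  (bin : T -> T -> B -> bool) (lt : rel T).

Definition tuple_type k :=
  ({ffun 'I_k * U -> bool} * {ffun 'I_k * 'I_k * B -> bool} *
   {ffun 'I_k * 'I_k -> bool})%type.

(** Equality of entries is encoded by the order: two entries are equal when neither is below the
    other. Types form a finite type, and on increasing tuples they classify the orbits. *)
Definition tp k (b : k.-tuple T) : tuple_type k :=
  ([ffun x => un (tnth b x.1) x.2],
   [ffun x => bin (tnth b x.1.1) (tnth b x.1.2) x.2],
   [ffun x => lt (tnth b x.1) (tnth b x.2)]).

Lemma tpP k (a b : k.-tuple T) : tp a = tp b <->
  [/\ forall i u, un (tnth a i) u = un (tnth b i) u,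
      forall i j c, bin (tnth a i) (tnth a j) c = bin (tnth b i) (tnth b j) c &
      forall i j, lt (tnth a i) (tnth a j) = lt (tnth b i) (tnth b j)].
Proof.
split=> [[/ffunP eu /ffunP eb /ffunP el]|[eu eb el]].
  split=> [i u|i j c|i j].
  - by have := eu (i, u); rewrite !ffunE.
  - by have := eb (i, j, c); rewrite !ffunE.
  - by have := el (i, j); rewrite !ffunE.
by congr (_, _, _); apply/ffunP => x; rewrite !ffunE.
Qed.

Definition incr k (b : k.-tuple T) :=
  forall i j, lt (tnth b i) (tnth b j) = (i < j).

Lemma incr_tp k (a b : k.-tuple T) : tp a = tp b -> incr b -> incr a.
Proof. by move=> /tpP[_ _ e] ib i j; rewrite e ib. Qed.

Lemma tp_incr k (a b : k.-tuple T) : incr a -> incr b ->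
  (forall i u, un (tnth a i) u = un (tnth b i) u) ->
  (forall i j c, i != j ->
     bin (tnth a i) (tnth a j) c = bin (tnth b i) (tnth b j) c) ->
  irrefl_bin bin -> tp a = tp b.
Proof.
move=> ia ib Hu Hb irr; apply/tpP; split=> // [i j c|i j]; last by rewrite ia ib.
by have [->|] := eqVneq i j; [rewrite !irr|exact: Hb].
Qed.

End Types.

(** * Unrelated copies of points and a generic tuple of stars *)

Section CleanExtension.
Variables (U B : finType) (Fam : fstr U B -> Prop).
Variables (T : countType) (un : T -> U -> bool) (bin : T -> T -> B -> bool)
  (lt : rel T).
Hypothesis irrFam : forall S, Fam S -> irreducible S.
Hypothesis limT : fraisse_limit un bin lt Fam.
Local Notation tp := (tp un bin lt).

Lemma incr_inj k (b : k.-tuple T) : incr lt b -> injective (tnth b).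
Proof.
move=> ib i j e; have := ib i j; have := ib j i; rewrite e (ltxx limT).
by move=> h1 h2; apply: val_inj => /=; lia.
Qed.

Variables (l : nat) (o : l.-tuple T) (D : {set 'I_l}) (Z : seq T)
  (c : l.-tuple T) (gs : seq (l.-tuple T)).
Hypotheses (incro : incr lt o) (tpc : tp c = tp o).
Hypothesis Hgs : forall a : l.-tuple T, a \in gs ->
  tp a = tp o /\ forall j, j \notin D -> tnth a j = tnth c j.

(* Besides [Z], the new points are, for each coordinate i, a copy (i, Some z) of
   every z in [Z], meant to replace z as an i-th coordinate only, and a star
   (i, None) related to everything as the i-th point of [o] is. *)
Local Notation node := (seq_sub Z + 'I_l * option (seq_sub Z))%type.

Definition fold_node (n : node) : T :=
  match n with
  | inl z => val z | inr (_, Some z) => val z | inr (i, None) => tnth o i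
  end.

(** The index at which the node can stand in a tuple of type [tp o] together with stars; nodes
    without a role are unrelated to all stars. *)
Definition role (n : node) : option 'I_l :=
  match n with
  | inl z => [pick j | (j \notin D) && (tnth c j == val z)]
  | inr (i, Some z) => if has (fun a => tnth a i == val z) gs then Some i else None
  | inr (i, None) => Some i
  end.

Definition star (n : node) := if n is inr (_, None) then true else false.

(** Between two copies a relation survives only if the pair looks like the corresponding pair of
    [o]. Thus sending nodes to their roles respects the surviving relations, while copies for the
    same coordinate are unrelated. *)
Definition keep (n m : node) : bool :=
  match n, m with
  | inr (i, _), inr (j, _) => (i != j) &&
     [forall b, (bin (fold_node n) (fold_node m) b == bin (tnth o i) (tnth o j) b)
             && (bin (fold_node m) (fold_node n) b == bin (tnth o j) (tnth o i) b)]
  | _, _ => true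
  end.

Definition node_un (n : node) u := un (fold_node n) u.

Definition node_bin (n m : node) b :=
  if star n || star m then
    if role n is Some i then
      if role m is Some j then bin (tnth o i) (tnth o j) b else false
    else false
  else keep n m && bin (fold_node n) (fold_node m) b.

Definition below z := count (fun y => lt y z) Z.

(* New points of coordinate i are placed just below the next fixed coordinate
   [tnth c j], j > i, hence above every point of [Z] that can be a smaller one. *)
Definition base (i : 'I_l) := count (fun y =>
  [forall j, (j \notin D) && (i < j) ==> lt y (tnth c j)]) Z.

Definition key3 x y z := (x * l.+1 + y) * (size Z).+1 + z.

(** Old points get odd positions and new ones even positions, so the two kinds never tie. New points
    at one position are sorted by coordinate, then by rank in [Z], with the star on top. *)
Definition key_pos (n : node) : nat :=
  match n with inl z => (below (val z)).*2.+1 | inr (i, _) => (base i).*2 end.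

Definition key_role (n : node) : nat :=
  match n with inl _ => 0 | inr (i, _) => i end.

Definition key_rank (n : node) : nat :=
  match n with
  | inl z => 0 | inr (_, Some z) => below (val z) | inr (_, None) => size Z
  end.

Definition key (n : node) := key3 (key_pos n) (key_role n) (key_rank n).

Lemma key3_lt x y z x' y' z' : y <= l -> y' <= l -> z <= size Z -> z' <= size Z ->
  (key3 x y z < key3 x' y' z') =
  (x < x') || (x == x') && ((y < y') || (y == y') && (z < z')).
Proof.
move=> yl yl' zl zl'; rewrite /key3 ltn_lex ?ltnS // ltn_lex ?ltnS //.
have -> : (x * l.+1 + y == x' * l.+1 + y') = (x == x') && (y == y').
  apply/eqP/andP => [e|[/eqP-> /eqP->]] //.
  have h1 := @ltn_lex l.+1 x y x' y' yl yl'; have h2 := @ltn_lex l.+1 x' y' x y yl' yl.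
  by rewrite e ltnn in h1 h2; lia.
by case: (ltngtP x x') => //=; rewrite ?orbF.
Qed.

Lemma key3_inj x y z x' y' z' : y <= l -> y' <= l -> z <= size Z -> z' <= size Z ->
  key3 x y z = key3 x' y' z' -> [/\ x = x', y = y' & z = z'].
Proof.
move=> yl yl' zl zl' e.
have h1 := @key3_lt x y z x' y' z' yl yl' zl zl'.
have h2 := @key3_lt x' y' z' x y z yl' yl zl' zl.
by rewrite e ltnn in h1 h2; split; lia.
Qed.

Lemma below_lt z y : z \in Z -> y \in Z -> (below z < below y) = lt z y.
Proof.
have L u v : u \in Z -> lt u v -> below u < below v.
  move=> uZ uv; apply: (@count_ltn _ _ _ _ u) => //; last by rewrite (ltxx limT).
  by move=> w /= wu; apply: (lt_trans limT) wu uv.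
move=> zZ yZ; apply/idP/idP => [h|]; last exact: L.
have [e|nzy] := eqVneq z y; first by rewrite e ltnn in h.
case/orP: (lt_total limT nzy) => // yz; have := L _ _ yZ yz; lia.
Qed.

Lemma below_inj z y : z \in Z -> y \in Z -> below z = below y -> z = y.
Proof.
move=> zZ yZ e; apply/eqP; apply: contraTT isT => nzy.
by have := lt_total limT nzy; rewrite -!below_lt // e ltnn.
Qed.

Lemma below_size z : z \in Z -> below z < size Z.
Proof.
move=> zZ; rewrite -(count_predT Z); apply: (@count_ltn _ _ _ _ z) => //.
by rewrite (ltxx limT).
Qed.

Lemma base_mono (i j : 'I_l) : i <= j -> base i <= base j.
Proof.
move=> ij; apply: sub_count => y /forallP H; apply/forallP => k.
by apply/implyP => /andP[kD jk]; apply: (implyP (H k)); rewrite kD /=; lia.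
Qed.

Lemma base_le (i j : 'I_l) : j \notin D -> i < j -> base i <= below (tnth c j).
Proof.
move=> jD ij; apply: sub_count => y /forallP /(_ j); by rewrite jD ij.
Qed.

Lemma base_gt z (i : 'I_l) : z \in Z ->
  (forall j : 'I_l, j \notin D -> i < j -> lt z (tnth c j)) -> below z < base i.
Proof.
move=> zZ H; apply: (@count_ltn _ _ _ _ z) => //.
- move=> y /= yz; apply/forallP => j; apply/implyP => /andP[jD ij].
  by apply: (lt_trans limT) yz _; apply: H.
- by apply/forallP => j; apply/implyP => /andP[jD ij]; apply: H.
- by rewrite (ltxx limT).
Qed.

Lemma key_role_le n : key_role n <= l.
Proof. by case: n => [z|[i x]] //=; rewrite ltnW. Qed.

Lemma key_rank_le n : key_rank n <= size Z.
Proof. by case: n => [z|[i [z|]]] //=; rewrite ltnW ?below_size ?(valP z). Qed.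

Lemma key_lt n m : (key n < key m) = (key_pos n < key_pos m) ||
  (key_pos n == key_pos m) && ((key_role n < key_role m) ||
     (key_role n == key_role m) && (key_rank n < key_rank m)).
Proof. by rewrite key3_lt ?key_role_le ?key_rank_le. Qed.

Lemma key_inj : injective key.
Proof.
have odd_even x y : x.*2.+1 = y.*2 -> False.
  by move=> /(congr1 odd) /=; rewrite !odd_double.
move=> n m /key3_inj[]; rewrite ?key_role_le ?key_rank_le //.
case: n m => [z|[i [z|]]] [y|[j [y|]]] //=.
- by move=> [/double_inj /below_inj e] _ _; congr inl; apply: val_inj; apply: e; apply: valP.
- by move=> /odd_even.
- by move=> /odd_even.
- by move=> /esym /odd_even.
- move=> _ /val_inj -> /below_inj e; congr (inr (_, Some _)).
  by apply: val_inj; apply: e; apply: valP.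
- by move=> _ _ e; have := below_size (valP z); rewrite e ltnn.
- by move=> /esym /odd_even.
- by move=> _ _ e; have := below_size (valP y); rewrite e ltnn.
- by move=> _ /val_inj ->.
Qed.

Lemma keepC n m : keep n m = keep m n.
Proof.
case: n m => [z|[i x]] [y|[j x']] //=; rewrite eq_sym; congr (_ && _).
by apply: eq_forallb => b; rewrite andbC.
Qed.

Lemma role_un n i u : role n = Some i -> un (fold_node n) u = un (tnth o i) u.
Proof.
case: n => [z|[j [z|]]] /=; last by case=> ->.
  by case: pickP => // j /andP[_ /eqP <-] [<-]; case/tpP: tpc => ->.
case: hasP => // [[a /Hgs[/tpP[H _ _] _] /eqP <-]] [<-]; exact: H.
Qed.

Lemma role_bin n m i j b : role n = Some i -> role m = Some j ->
  ~~ star n -> ~~ star m -> keep n m ->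
  bin (fold_node n) (fold_node m) b = bin (tnth o i) (tnth o j) b.
Proof.
case: n => [z|[i' [z|]]] //=; case: m => [y|[j' [y|]]] //=.
- case: pickP => // i' /andP[_ /eqP <-] [<-].
  by case: pickP => // j' /andP[_ /eqP <-] [<-] _ _ _; case/tpP: tpc => _ ->.
- case: pickP => // i' /andP[iD /eqP <-] [<-].
  case: hasP => // [[a /Hgs[/tpP[_ H _] e] /eqP <-]] [<-] _ _ _.
  by rewrite -(e _ iD) H.
- case: hasP => // [[a /Hgs[/tpP[_ H _] e] /eqP <-]] [<-].
  by case: pickP => // j' /andP[jD /eqP <-] [<-] _ _ _; rewrite -(e _ jD) H.
- case: ifP => // _ [<-]; case: ifP => // _ [<-] _ _ /andP[_ /forallP /(_ b)].
  by case/andP=> /eqP.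
Qed.

Lemma node_bin_irrefl : irrefl_bin node_bin.
Proof.
move=> n b; rewrite /node_bin; case: ifP => _.
  by case: (role n) => // i; rewrite (bin_irrefl limT).
by rewrite (bin_irrefl limT) andbF.
Qed.

(** If a forbidden structure contains a star, each of its other vertices is related to that star and
    so has a role; roles then fold it into [o]. Without stars, [fold_node] embeds it in the
    limit. *)
Lemma node_forb : forb Fam node_un node_bin.
Proof.
move=> S FS [f [injf [fu fb]]]; apply: (forbT limT FS).
pose q n := if role n is Some i then tnth o i else fold_node n.
have [/existsP[x0 sx0]|nstar] := boolP [exists x, star (f x)].
  have rk x : exists i, role (f x) = Some i.
    have [->|nx] := eqVneq x x0.
      by case: (f x0) sx0 => [//|[i [//|]]] _; exists i.
    have [b] := irrFam FS nx; rewrite -!fb /node_bin sx0 orbT /=.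
    by case: (role (f x)) => [i|]; [exists i|case: (role (f x0))].
  apply: (@embeds_fold _ _ _ _ _ _ _ limT _ _ _ _ f q (irrFam FS) node_bin_irrefl fu fb).
    by move=> x u; rewrite /q; have [i e] := rk x; rewrite e -(role_un _ e).
  move=> x y b _; rewrite /q; have [i e] := rk x; have [j e'] := rk y.
  rewrite e e' /node_bin e e' [star (f y) || _]orbC [keep (f y) _]keepC.
  case: ifP => // /norP[sx sy] h b'.
  have kp : keep (f x) (f y) by case: (keep _ _) h.
  by rewrite kp /= -(role_bin _ e e' sx sy kp).
apply: (@embeds_fold _ _ _ _ _ _ _ limT _ _ _ _ f fold_node (irrFam FS) node_bin_irrefl fu fb) => //.
rewrite negb_exists in nstar; move/forallP: nstar => ns.
move=> x y b _; rewrite /node_bin !(negPf (ns _)) /= [keep (f y) _]keepC.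
by case: (keep _ _).
Qed.

Lemma role_base (i : 'I_l) (z : seq_sub Z) :
  i \notin D -> tnth c i = val z -> role (inl z) = Some i.
Proof.
move=> iD ei /=; case: pickP => [j /andP[_ /eqP ej]|/(_ i)]; last by rewrite iD ei eqxx.
by congr Some; apply: (incr_inj (incr_tp tpc incro)); rewrite ej ei.
Qed.

(** An old coordinate after a fresh one must be fixed, because fresh points are only known to lie
    below the later fixed coordinates. *)
Lemma key_incr (b : l.-tuple T) (v : 'I_l -> seq_sub Z) (fresh : pred 'I_l)
    (x : 'I_l -> option (seq_sub Z)) (i j : 'I_l) :
  incr lt b -> (forall i, val (v i) = tnth b i) ->
  (forall i, i \notin D -> tnth b i = tnth c i) ->
  (forall i j : 'I_l, i < j -> fresh i -> ~~ fresh j -> j \notin D) -> i < j ->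
  key (if fresh i then inr (i, x i) else inl (v i)) <
  key (if fresh j then inr (j, x j) else inl (v j)).
Proof.
move=> ib ev bc fr ij; rewrite key_lt.
have bZ k : tnth b k \in Z by rewrite -ev; apply: valP.
have [fi|fi] := boolP (fresh i); have [fj|fj] := boolP (fresh j); rewrite /= ?ev.
- by have := base_mono (ltnW ij); rewrite leq_eqVlt => /orP[/eqP->|]; lia.
- have jD := fr _ _ ij fi fj; rewrite bc //.
  by have := base_le jD ij; lia.
- have : below (tnth b i) < base j.
    by apply: base_gt => // j' j'D jj'; rewrite -bc // ib (ltn_trans ij).
  lia.
- have : below (tnth b i) < below (tnth b j) by rewrite below_lt // ib.
  lia.
Qed.

Definition mix (S : {set 'I_l}) (a a' : l.-tuple T) : l.-tuple T :=
  [tuple if i \in S then tnth a' i else tnth a i | i < l].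

Definition tail_copy (t : 'I_l -> T -> T) k (b : l.-tuple T) : l.-tuple T :=
  [tuple if (i \in D) && (k <= i) then t i (tnth b i) else tnth b i | i < l].

(* Only the last coordinates are replaced in [tail_copy]: mixing old and new
   coordinates in another pattern would break the order. *)
Lemma clean_copies : (forall (a : l.-tuple T) i, a \in gs -> tnth a i \in Z) ->
  exists (t : 'I_l -> T -> T) (st : l.-tuple T), [/\
   forall k b, tp b = tp o -> (forall j, tnth b j \in Z) ->
     (forall j, j \notin D -> tnth b j = tnth c j) -> tp (tail_copy t k b) = tp o,
   forall (a : l.-tuple T) (S : {set 'I_l}), a \in gs -> S \subset D -> tp (mix S (tail_copy t 0 a) st) = tp o,
   forall i z, z \in Z -> [/\ z != t i z, forall b, bin z (t i z) b = false &
      forall b, bin (t i z) z b = false],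
   forall i z y, z \in Z -> y \in Z -> (z != y -> t i z != t i y) /\
      forall b, bin (t i z) (t i y) b = false &
   forall i z, z \in Z -> [/\ t i z != tnth st i,
      forall b, bin (t i z) (tnth st i) b = false &
      forall b, bin (tnth st i) (t i z) b = false]].
Proof.
move=> gsZ.
have [//|z y b|z y|e [ei einj eu eb el]] := extension limT
    (strict_total_key key_inj) node_bin_irrefl node_forb.
- by rewrite /node_bin.
- rewrite /= key_lt /= andbF orbF.
  rewrite -(below_lt (valP z) (valP y)). by rewrite ltnS ltn_double.
(* Both required types are obtained by choosing one node per coordinate. *)
have realize (nu : 'I_l -> node) :
    (forall i u, un (fold_node (nu i)) u = un (tnth o i) u) ->
    (forall i j b, i != j -> node_bin (nu i) (nu j) b = bin (tnth o i) (tnth o j) b) ->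
    (forall i j : 'I_l, i < j -> key (nu i) < key (nu j)) ->
    tp [tuple e (nu i) | i < l] = tp o.
  move=> nu1 nu2 nu3; apply: tp_incr => //.
  - move=> i j; rewrite !tnth_mktuple el.
    have [/nu3 //|/nu3|/val_inj ->] := ltngtP i j; last by rewrite ltnn.
    by move=> h; apply/negbTE; lia.
  - by move=> i u; rewrite tnth_mktuple eu /node_un nu1.
  - by move=> i j b ij; rewrite !tnth_mktuple eb nu2.
  - by move=> x b; apply: (bin_irrefl limT).
pose t i z := if insub z is Some z' then e (inr (i, Some z')) else z.
have tE i (z : seq_sub Z) : t i (val z) = e (inr (i, Some z)) by rewrite /t valK.
have [st stE] : exists st : l.-tuple T, forall i, tnth st i = e (inr (i, None)).
  by exists [tuple e (inr (i, None)) | i < l] => i; rewrite tnth_mktuple.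
have pair_bin (b : l.-tuple T) (i j : 'I_l) (n m : node) x : tp b = tp o -> i != j ->
    fold_node n = tnth b i -> fold_node m = tnth b j -> ~~ star n -> ~~ star m ->
    (if n is inr (i', _) then i' == i else true) ->
    (if m is inr (j', _) then j' == j else true) ->
    node_bin n m x = bin (tnth o i) (tnth o j) x.
  move=> /tpP[_ hb _] ij en em /negPf sn /negPf sm ni mj.
  rewrite /node_bin sn sm /= en em hb.
  suff -> : keep n m by [].
  case: n m en em {sn sm} ni mj => [z|[i' z]] [y|[j' y]] //= -> -> /eqP-> /eqP->.
  by rewrite ij; apply/forallP => x'; rewrite !hb !eqxx.
exists t, st; split.
- move=> k b tb bZ bc.
  pose v i := SeqSub (bZ i).
  pose fresh (i : 'I_l) := (i \in D) && (k <= i).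
  have -> : tail_copy t k b =
      [tuple e (if fresh i then inr (i, Some (v i)) else inl (v i)) | i < l].
    apply: eq_from_tnth => i; rewrite !tnth_mktuple -/(fresh i).
    by case: (fresh i); rewrite ?ei // -(tE i (v i)).
  apply: realize => [i u|i j x ij|i j ij].
  - by case/tpP: tb => hu _ _; case: (fresh i); rewrite /= hu.
  - by apply: (@pair_bin b) => //; first [by case: (fresh i) | by case: (fresh j)].
  - apply: (@key_incr b v fresh (fun i => Some (v i))) => //.
      exact: incr_tp tb incro.
    move=> {ij} i' j' ij /andP[_ ki]; rewrite negb_and => /orP[//|].
    by rewrite (leq_trans ki (ltnW ij)).
- move=> a S ags SD; have [ta ac] := Hgs ags.
  pose v i := SeqSub (gsZ a i ags).
  pose x i := if i \in S then None else Some (v i).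
  have -> : mix S (tail_copy t 0 a) st =
      [tuple e (if i \in D then inr (i, x i) else inl (v i)) | i < l].
    apply: eq_from_tnth => i; rewrite !tnth_mktuple leq0n andbT /x.
    have [iS|iS] := boolP (i \in S); first by rewrite (subsetP SD) // stE.
    by case: ifP => _; rewrite ?ei // -(tE i (v i)).
  (* Each chosen node has its own coordinate as role, so its relations to the stars are those of
     [o]. *)
  have ra i : role (if i \in D then inr (i, x i) else inl (v i)) = Some i.
    have [iD|iD] := boolP (i \in D); last by apply: role_base => //; rewrite -ac.
    rewrite /x; case: ifP => //= _; case: hasP => // [[]].
    by exists a.
  apply: realize => [i u|i j b ij|i j ij].
  - exact: role_un.
  - have [/orP[s|s]|] := boolP (star (if i \in D then inr (i, x i) else inl (v i)) ||
        star (if j \in D then inr (j, x j) else inl (v j))).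
    + by rewrite /node_bin s !ra.
    + by rewrite /node_bin s orbT !ra.
    rewrite negb_or => /andP[]; rewrite /x => si sj.
    apply: (@pair_bin a) => //.
    + by move: si; case: (i \in D) => //; case: (i \in S).
    + by move: sj; case: (j \in D) => //; case: (j \in S).
    + by case: (i \in D) => /=.
    + by case: (j \in D) => /=.
  - apply: (@key_incr a v (fun i => i \in D) x) => //.
    exact: incr_tp ta incro.
- move=> i z zZ; pose z' := SeqSub zZ; rewrite -[z]/(val z') tE -[val z']ei.
  split; first by rewrite (inj_eq einj).
    by move=> b; rewrite eb /node_bin /= (bin_irrefl limT).
  by move=> b; rewrite eb /node_bin /= (bin_irrefl limT).
- move=> i z y zZ yZ; pose z' := SeqSub zZ; pose y' := SeqSub yZ.
  rewrite -[z]/(val z') -[y]/(val y') !tE; split=> [zy|b].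
    by rewrite (inj_eq einj); apply: contraNneq zy => -[ezy]; apply/eqP; exact: ezy.
  by rewrite eb /node_bin /= eqxx.
- move=> i z zZ; pose z' := SeqSub zZ; rewrite -[z]/(val z') tE stE.
  split; first by apply/eqP => /einj.
    move=> b; rewrite eb /node_bin orbT /=; case: ifP => // _.
    exact: (bin_irrefl limT).
  move=> b; rewrite eb /node_bin /=; case: ifP => // _.
  exact: (bin_irrefl limT).
Qed.

End CleanExtension.

Local Open Scope ring_scope.

(** * Chains with zero face sums are combinations of cubes *)

Lemma sum_subsetD1 (I : finType) (V : nmodType) (D : {set I}) k (G : {set I} -> V) :
  k \in D -> \sum_(S : {set I} | S \subset D) G S =
    \sum_(S : {set I} | S \subset D :\ k) (G S + G (k |: S)).
Proof.
move=> kD; rewrite big_split /= (bigID (fun S : {set I} => k \notin S)) /=.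
congr (_ + _); first by apply: eq_bigl => S; rewrite subsetD1.
rewrite (reindex_onto (fun S : {set I} => k |: S) (fun S => S :\ k)) /=; last first.
  by move=> S /andP[_]; rewrite negbK => kS; rewrite setD1K.
apply: eq_bigl => S; rewrite setU11 subUset sub1set kD /= andbT subsetD1.
congr (_ && _); apply/eqP/idP => [<-|kS].
  by rewrite setD11.
by rewrite setU1K.
Qed.

Section Span.
Variables (U B : finType) (Fam : fstr U B -> Prop).
Variables (T : countType) (un : T -> U -> bool) (bin : T -> T -> B -> bool)
  (lt : rel T).
Hypothesis irrFam : forall S, Fam S -> irreducible S.
Hypothesis limT : fraisse_limit un bin lt Fam.
Local Notation tp := (tp un bin lt).
Variables (F : fieldType) (V : lmodType F) (l : nat) (o : l.-tuple T).
Hypothesis incro : incr lt o.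

(** A formal combination of tuples with coefficients in [V] is handled through its pairings with all
    scalar functions [phi]; equality of chains means equality of all pairings. *)
Definition chain_eval (s : seq (V * l.-tuple T)) (phi : l.-tuple T -> F) : V :=
  \sum_(x <- s) phi x.2 *: x.1.

Definition cube (D : {set 'I_l}) (p : l.-tuple T * l.-tuple T)
    (phi : l.-tuple T -> F) : F :=
  \sum_(S : {set 'I_l} | S \subset D) (-1) ^+ #|S| * phi (mix S p.1 p.2).

Definition cubes_eval (D : {set 'I_l}) (m : seq (V * (l.-tuple T * l.-tuple T)))
    (phi : l.-tuple T -> F) : V :=
  \sum_(x <- m) cube D x.2 phi *: x.1.

Definition valid_cube (D : {set 'I_l}) (p : l.-tuple T * l.-tuple T) :=
  (forall S : {set 'I_l}, S \subset D -> tp (mix S p.1 p.2) = tp o) /\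
  (forall i, i \in D -> [/\ tnth p.1 i != tnth p.2 i,
     forall b, bin (tnth p.1 i) (tnth p.2 i) b = false &
     forall b, bin (tnth p.2 i) (tnth p.1 i) b = false]).

(** Vanishing on all such [phi] says that the chain becomes zero when coordinate i is forgotten,
    that is, has zero sum along direction i. *)
Definition indep (i : 'I_l) (phi : l.-tuple T -> F) :=
  forall b b' : l.-tuple T, (forall j, j != i -> tnth b j = tnth b' j) -> phi b = phi b'.

(** Stated for a set [D] of directions to allow induction on [D]; [E] records that the coefficients
    of the cubes are taken among those of the chain. *)
Definition spans (D : {set 'I_l}) := forall (E : V -> Prop) s,
  (forall x, x \in s -> tp x.2 = tp o /\ E x.1) ->
  (forall i, i \in D -> forall phi, indep i phi -> chain_eval s phi = 0) ->
  exists m, (forall x, x \in m -> valid_cube D x.2 /\ E x.1) /\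
    forall phi, chain_eval s phi = cubes_eval D m phi.

Lemma mix0 (a a' : l.-tuple T) : mix set0 a a' = a.
Proof. by apply: eq_from_tnth => i; rewrite tnth_mktuple inE. Qed.

(** A cube is the difference of its two opposite faces in direction k, here the images under [f] and
    [g] of one smaller cube. *)
Lemma cube_shift (D : {set 'I_l}) (k : 'I_l) (a a' A A' : l.-tuple T)
    (f g : l.-tuple T -> l.-tuple T) phi : k \in D ->
  (forall S : {set 'I_l}, S \subset D :\ k -> mix S A A' = f (mix S a a')) ->
  (forall S : {set 'I_l}, S \subset D :\ k -> mix (k |: S) A A' = g (mix S a a')) ->
  cube D (A, A') phi =
  cube (D :\ k) (a, a') (phi \o f) - cube (D :\ k) (a, a') (phi \o g).
Proof.
move=> kD hf hg; rewrite /cube (sum_subsetD1 _ kD) -sumrB /=.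
apply: eq_bigr => S SD; rewrite hf // hg //.
have kS : k \notin S by move: SD; rewrite subsetD1 => /andP[].
by rewrite cardsU1 kS exprS mulN1r mulNr.
Qed.

(* With the coordinates outside [D] fixed: changing u = [s] into its copy one
   coordinate k of [D] at a time adds [D]-cubes, because u is a combination of
   (D \ k)-cubes. For the final copy and the stars, the sum of the cubes
   [(tail_copy 0 a, st)] over u is that copy itself: every other vertex term forgets
   a coordinate, so it vanishes. *)
Lemma spans_const (D : {set 'I_l}) (c : l.-tuple T) (E : V -> Prop) s :
  (forall k, k \in D -> spans (D :\ k)) -> tp c = tp o ->
  (forall x, x \in s -> tp x.2 = tp o /\ E x.1) ->
  (forall i, i \in D -> forall phi, indep i phi -> chain_eval s phi = 0) ->
  (forall x, x \in s -> forall j, j \notin D -> tnth x.2 j = tnth c j) ->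
  exists m, (forall x, x \in m -> valid_cube D x.2 /\ E x.1) /\
    forall phi, chain_eval s phi = cubes_eval D m phi.
Proof.
move=> IH tpc Es faces sc.
have /fin_all_exists[m Hm] : forall k : 'I_l, exists mk, k \in D ->
    (forall x, x \in mk -> [/\ valid_cube (D :\ k) x.2, E x.1 &
       forall j, j \notin D -> tnth x.2.1 j = tnth c j]) /\
    (forall phi, chain_eval s phi = cubes_eval (D :\ k) mk phi).
  move=> k; have [kD|] := boolP (k \in D); last by exists [::].
  have [||mk [mk1 mk2]] := IH k kD E s => //.
    by move=> i /setD1P[_ iD]; apply: faces.
  pose chi (b : l.-tuple T) := [forall j, (j \notin D) ==> (tnth b j == tnth c j)].
  exists [seq x <- mk | chi x.2.1] => _; split=> [x|phi].
    rewrite mem_filter => /andP[/forallP h /mk1[? ?]]; split=> // j jD.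
    by apply/eqP; apply: (implyP (h j)).
  (* All tuples of [s] satisfy [chi], so weighting by it changes nothing; as it is constant on each
     cube in directions [D :\ k], the cubes violating it drop out. *)
  transitivity (chain_eval s (fun b => (chi b)%:R * phi b)).
    rewrite /chain_eval !big_seq; apply: eq_bigr => x xs.
    have -> : chi x.2; last by rewrite mul1r.
    by apply/forallP => j; apply/implyP => jD; rewrite (sc x xs).
  rewrite mk2 /cubes_eval big_filter [RHS]big_mkcond; apply: eq_bigr => x _.
  have -> : cube (D :\ k) x.2 (fun b => (chi b)%:R * phi b) =
      (chi x.2.1)%:R * cube (D :\ k) x.2 phi.
    rewrite /cube mulr_sumr; apply: eq_bigr => S SD.
    have -> : chi (mix S x.2.1 x.2.2) = chi x.2.1; last by ring.
    apply: eq_forallb => j; case: (boolP (j \in D)) => //= jD.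
    rewrite tnth_mktuple ifN //; apply: contra jD => jS.
    by have /setD1P[] := subsetP SD _ jS.
  by case: (chi _); rewrite ?mul1r ?mul0r ?scale0r.
pose Z : seq T := flatten [seq val x.2 | x <- s] ++
  flatten [seq flatten [seq val x.2.1 ++ val x.2.2 | x <- m k] | k <- enum 'I_l].
have Zs x i : x \in s -> tnth x.2 i \in Z.
  move=> xs; rewrite mem_cat; apply/orP; left; apply/flattenP.
  by exists (val x.2); [apply: map_f|apply: mem_tnth].
have Zm k x i : x \in m k -> (tnth x.2.1 i \in Z) && (tnth x.2.2 i \in Z).
  move=> xs; rewrite !mem_cat; apply/andP; split; apply/orP; right; apply/flattenP;
  (exists (flatten [seq val x.2.1 ++ val x.2.2 | x <- m k]);
    first by apply: map_f; rewrite mem_enum);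
  (apply/flattenP; exists (val x.2.1 ++ val x.2.2);
    first exact: (map_f (fun x : V * (l.-tuple T * l.-tuple T) => val x.2.1 ++ val x.2.2)));
  by rewrite mem_cat mem_tnth ?orbT.
have [|a i|t [st [tA tB tC tD tE]]] :=
    @clean_copies _ _ Fam _ _ _ _ irrFam limT _ o D Z c (map snd s) incro tpc.
- by move=> a /mapP[x xs ->]; split; [case: (Es x xs)|apply: sc].
- by move=> /mapP[x xs ->]; apply: Zs.
pose tl := tail_copy D t.
(* Copying proceeds from the last coordinate downwards: [tl l] copies nothing and [tl 0] copies all
   of [D]. *)
have shift n : exists m', (forall x, x \in m' -> valid_cube D x.2 /\ E x.1) /\
    forall phi, chain_eval s phi = cubes_eval D m' phi + chain_eval s (phi \o tl (l - n)%N).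
  elim: n => [|n [m' [m'1 m'2]]].
    exists [::]; split=> // phi; rewrite /cubes_eval big_nil add0r.
    apply: eq_bigr => x _ /=; congr (phi _ *: _); apply: eq_from_tnth => i.
    by rewrite tnth_mktuple subn0 leqNgt ltn_ord andbF.
  have [ln|nl] := leqP l n.
    by exists m'; split=> // phi; rewrite m'2; congr (_ + chain_eval s (phi \o tl _)); lia.
  have kl : (l - n.+1 < l)%N by lia.
  pose k := Ordinal kl.
  have kS : (l - n = k.+1)%N by rewrite /=; lia.
  rewrite -[(l - n.+1)%N]/(k : nat) {}kS in m'2 *.
  have [kD|kD] := boolP (k \in D); last first.
    exists m'; split=> // phi; rewrite m'2; congr (_ + _); apply: eq_bigr => x _ /=.
    congr (phi _ *: _); apply: eq_from_tnth => i; rewrite !tnth_mktuple.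
    have [->|ik] := eqVneq i k; first by rewrite (negPf kD).
    by rewrite ltn_neqAle eq_sym -val_eqE in ik *; rewrite ik.
  have [mk1 mk2] := Hm k kD.
  (* The cube ([A], [A']) has as its k-faces the images of the cube (a, a') under [tl k.+1] and
     [tl k], so summing over [m k] gives the change from one copy to the next. *)
  pose A (a : l.-tuple T) := tl k.+1 a.
  pose A' (a a' : l.-tuple T) :=
    [tuple if i == k then t k (tnth a k) else tnth (tl k.+1 a') i | i < l].
  have M1 (a a' : l.-tuple T) (S : {set 'I_l}) : S \subset D :\ k ->
      mix S (A a) (A' a a') = tl k.+1 (mix S a a').
    move=> SD; apply: eq_from_tnth => i; rewrite !tnth_mktuple.
    have [iS|iS] := boolP (i \in S); last by [].
    by have /setD1P[/negPf->] := subsetP SD _ iS.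
  have M2 (a a' : l.-tuple T) (S : {set 'I_l}) : S \subset D :\ k ->
      mix (k |: S) (A a) (A' a a') = tl k (mix S a a').
    move=> SD; apply: eq_from_tnth => i; rewrite !tnth_mktuple !inE.
    have [->|ik] /= := eqVneq i k.
      rewrite kD leqnn ifN //; apply/negP => kS.
      by have := subsetP SD _ kS; rewrite setD11.
    have -> : (k <= i)%N = (k < i)%N.
      by rewrite ltn_neqAle eq_sym -val_eqE in ik *; rewrite ik.
    by case: (i \in S).
  exists (m' ++ [seq (x.1, (A x.2.1, A' x.2.1 x.2.2)) | x <- m k]); split=> [x|phi].
    rewrite mem_cat => /orP[/m'1//|/mapP[y ym ->]] /=.
    have [[v1 v2] Ey yc] := mk1 _ ym; split=> //.
    have mixZ (S : {set 'I_l}) i : tnth (mix S y.2.1 y.2.2) i \in Z.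
      by rewrite tnth_mktuple; have /andP[] := Zm _ _ i ym; case: ifP.
    have mixc (S : {set 'I_l}) i : S \subset D :\ k -> i \notin D ->
        tnth (mix S y.2.1 y.2.2) i = tnth c i.
      move=> SD iD; rewrite tnth_mktuple ifN ?yc //; apply: contra iD => iS.
      by have /setD1P[] := subsetP SD _ iS.
    split=> [S SD|i iD] /=.
      have [kS|kS] := boolP (k \in S).
        have SkD : S :\ k \subset D :\ k by apply: setSD.
        by rewrite -(setD1K kS) M2 // tA ?v1 // => j jD; apply: mixc.
      have SkD : S \subset D :\ k by rewrite subsetD1 SD.
      by rewrite M1 // tA ?v1 // => j jD; apply: mixc.
    rewrite !tnth_mktuple iD /=; have /andP[Z1 Z2] := Zm _ _ i ym.
    have [->|ik] := eqVneq i k.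
      by rewrite ltnn; apply: tC; have /andP[] := Zm _ _ k ym.
    have [|h1 h2 h3] := v2 i; first by rewrite !inE ik.
    case: ifP => // _; have [d1 d2] := tD i _ _ Z1 Z2; have [_ d3] := tD i _ _ Z2 Z1.
    by split=> //; apply: d1.
  rewrite m'2 /cubes_eval big_cat /= -addrA; congr (_ + _).
  rewrite big_map -[LHS](subrK (chain_eval s (phi \o tl k))); congr (_ + _).
  rewrite !mk2 /cubes_eval -sumrB; apply: eq_bigr => x _.
  rewrite -scalerBl; congr (_ *: _).
  by rewrite [in RHS](@cube_shift D k x.2.1 x.2.2 _ _ (tl k.+1) (tl k)) -?surjective_pairing //; auto.
have [m' [m'1 m'2]] := shift l; rewrite subnn in m'2.
exists (m' ++ [seq (x.1, (tl 0 x.2, st)) | x <- s]); split=> [x|phi].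
  rewrite mem_cat => /orP[/m'1//|/mapP[y ys ->]] /=.
  have [_ Ey] := Es _ ys; split=> //; split=> [S SD|i iD] /=.
    by apply: tB => //; apply: map_f.
  by rewrite tnth_mktuple iD; apply: tE; apply: Zs.
rewrite m'2 /cubes_eval big_cat /=; congr (_ + _); rewrite big_map.
transitivity (\sum_(S : {set 'I_l} | S \subset D)
    (-1) ^+ #|S| *: chain_eval s (fun b => phi (mix S (tl 0 b) st))); last first.
  under [RHS]eq_bigr do rewrite /cube scaler_suml.
  rewrite exchange_big; apply: eq_bigr => S _; rewrite /chain_eval scaler_sumr.
  by apply: eq_bigr => x _; rewrite scalerA.
rewrite (bigD1 set0) ?sub0set //= cards0 scale1r big1 ?addr0.
  by apply: eq_bigr => x _ /=; rewrite mix0.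
move=> S /andP[SD /set0Pn[i iS]]; rewrite (faces i) ?scaler0 ?(subsetP SD) //.
move=> b b' bb'; congr phi; apply: eq_from_tnth => j; rewrite !tnth_mktuple.
case: ifP => // jS; rewrite bb' //.
by apply: contraFneq jS => ->.
Qed.

(** Outer induction on the size of [D], inner on the length of the chain: the tuples agreeing with
    the first one outside [D] are split off and treated by [spans_const]. Both parts keep zero face
    sums because the splitting does not look at coordinates in [D]. *)
Lemma span_cubes (D : {set 'I_l}) : spans D.
Proof.
have [n] := ubnP #|D|; elim: n D => // n IHn D Dn.
have IH k : k \in D -> spans (D :\ k).
  by move=> kD; apply: IHn; move: Dn; rewrite (cardsD1 k) kD; lia.
move=> E s; have [N] := ubnP (size s); elim: N s => // N IHN [|x s] sN Es faces.
  by exists [::]; split=> // phi; rewrite /chain_eval /cubes_eval !big_nil.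
pose chi (y : V * l.-tuple T) :=
  [forall j, (j \notin D) ==> (tnth y.2 j == tnth x.2 j)].
pose s1 := filter chi (x :: s); pose s2 := filter (predC chi) (x :: s).
have chix : chi x by apply/forallP => j; rewrite eqxx implybT.
have chain_evalD phi : chain_eval (x :: s) phi = chain_eval s1 phi + chain_eval s2 phi.
  by rewrite /chain_eval !big_filter (bigID chi).
have indep_chi i phi (P : bool -> bool) : i \in D -> indep i phi ->
    indep i (fun b => (P (chi (0, b)))%:R * phi b).
  move=> iD ip b b' bb'; rewrite (ip _ _ bb'); congr ((P _)%:R * _).
  apply: eq_forallb => j /=; case: (eqVneq j i) => [->|ji]; first by rewrite iD.
  by rewrite bb'.
have [||||m1 [m11 m12]] := @spans_const D x.2 E s1 IH _ _ _ _.
- by case: (Es x (mem_head _ _)).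
- by move=> y; rewrite mem_filter => /andP[_ /Es].
- move=> i iD phi ip; rewrite -[RHS](faces i iD _ (indep_chi i phi id iD ip)).
  rewrite /chain_eval big_filter big_mkcond; apply: eq_bigr => y _ /=.
  by rewrite {1}/chi -/(chi (0, y.2)); case: (chi _); rewrite ?mul1r // mul0r scale0r.
- move=> y; rewrite mem_filter => /andP[/forallP h _] j jD;
  apply/eqP; exact: implyP (h j) _.
have [|||m2 [m21 m22]] := IHN s2.
- rewrite size_filter /= chix /= add0n.
  by have := count_size (predC chi) s; move: sN => /=; lia.
- by move=> y; rewrite mem_filter => /andP[_ /Es].
- move=> i iD phi ip; rewrite -[RHS](faces i iD _ (indep_chi i phi negb iD ip)).
  rewrite /chain_eval big_filter big_mkcond; apply: eq_bigr => y _ /=.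
  by rewrite {1}/chi -/(chi (0, y.2)); case: (chi _); rewrite ?mul1r // mul0r scale0r.
exists (m1 ++ m2); split=> [y|phi].
  by rewrite mem_cat => /orP[/m11|/m21].
by rewrite chain_evalD m12 m22 /cubes_eval big_cat.
Qed.

End Span.

(** * The restriction maps and their face sums *)

Section Restriction.
Variables (U B : finType).
Variables (T : countType) (un : T -> U -> bool) (bin : T -> T -> B -> bool)
  (lt : rel T).
Local Notation tp := (tp un bin lt).
Local Notation isAut := (isAut un bin lt).
Variables (F : fieldType) (d : nat).
Local Notation vect := (d.-tuple T -> F).

(** Finite support is a mere existence statement, so a list covering the support is chosen; by
    [integE] pairings do not depend on it. *)
Definition supp (v : vect) : seq (d.-tuple T) :=
  undup (epsilon (inhabits [::]) (fun s => forall x, v x != 0 -> x \in s)).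

Definition integ (v : vect) (phi : d.-tuple T -> F) : F :=
  \sum_(c <- supp v) phi c * v c.

Lemma supp_uniq v : uniq (supp v).
Proof. exact: undup_uniq. Qed.

Lemma mem_supp v x : finsupp v -> v x != 0 -> x \in supp v.
Proof. by move=> fv; rewrite mem_undup; apply: (epsilon_spec (inhabits [::]) _ fv). Qed.

Lemma integE v s phi : finsupp v -> uniq s -> (forall x, v x != 0 -> x \in s) ->
  integ v phi = \sum_(c <- s) phi c * v c.
Proof.
move=> fv us sv.
have H r : \sum_(c <- r) phi c * v c = \sum_(c <- [seq c <- r | v c != 0]) phi c * v c.
  rewrite big_filter [RHS]big_mkcond; apply: eq_bigr => c _.
  by case: eqVneq => [->|]; rewrite ?mulr0.
rewrite /integ H [RHS]H; apply: perm_big; apply: uniq_perm.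
- exact/filter_uniq/supp_uniq.
- exact/filter_uniq.
- move=> c; rewrite !mem_filter; case: (boolP (v c != 0)) => //= vc.
  by rewrite mem_supp ?sv.
Qed.

Lemma finsupp0 : finsupp (fun _ : d.-tuple T => 0 : F).
Proof. by exists [::] => x; rewrite eqxx. Qed.

Lemma finsuppD (v w : vect) : finsupp v -> finsupp w -> finsupp (fun c => v c + w c).
Proof.
move=> fv fw; exists (supp v ++ supp w) => x; rewrite mem_cat.
have [v0|/(mem_supp fv)->//] := eqVneq (v x) 0.
by rewrite v0 add0r => /(mem_supp fw)->; rewrite orbT.
Qed.

Lemma finsuppZ (v : vect) a : finsupp v -> finsupp (fun c => a * v c).
Proof.
move=> fv; exists (supp v) => x; have [->|/(mem_supp fv)//] := eqVneq (v x) 0.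
by rewrite mulr0 eqxx.
Qed.

Lemma map_tupleK k (g h : T -> T) : cancel g h -> cancel (@map_tuple k _ _ g) (map_tuple h).
Proof. by move=> gh c; apply: eq_from_tnth => i; rewrite !tnth_map gh. Qed.

Lemma finsupp_act (v : vect) g h : isAut g h -> finsupp v ->
  finsupp (fun c => v (map_tuple h c)).
Proof.
move=> [gh [hg _]] fv; exists (map (map_tuple g) (supp v)) => x /(mem_supp fv) xs.
by rewrite -[x](map_tupleK hg); apply: map_f.
Qed.

Lemma eq_integ v phi psi : phi =1 psi -> integ v phi = integ v psi.
Proof. by move=> e; apply: eq_bigr => c _; rewrite e. Qed.

Lemma integ_eq0 v phi : (forall c, phi c = 0) -> integ v phi = 0.
Proof. by move=> e; rewrite /integ big1 // => c _; rewrite e mul0r. Qed.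

Lemma integD v w phi : finsupp v -> finsupp w ->
  integ (fun c => v c + w c) phi = integ v phi + integ w phi.
Proof.
move=> fv fw; pose s := undup (supp v ++ supp w).
have us : uniq s by apply: undup_uniq.
have vs x : v x != 0 -> x \in s by rewrite mem_undup mem_cat => /(mem_supp fv)->.
have ws x : w x != 0 -> x \in s.
  by rewrite mem_undup mem_cat => /(mem_supp fw)->; rewrite orbT.
rewrite (integE _ (finsuppD fv fw) us) ?(integE _ fv us) ?(integE _ fw us) //.
  by rewrite -big_split /=; apply: eq_bigr => c _; rewrite mulrDr.
move=> x; have [v0|/vs//] := eqVneq (v x) 0.
by rewrite v0 add0r => /ws.
Qed.

Lemma integZ v a phi : finsupp v -> integ (fun c => a * v c) phi = a * integ v phi.
Proof.
move=> fv; rewrite (integE _ (finsuppZ a fv) (supp_uniq v)).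
  by rewrite /integ mulr_sumr; apply: eq_bigr => c _; rewrite mulrCA.
move=> x; have [->|/(mem_supp fv)//] := eqVneq (v x) 0.
by rewrite mulr0 eqxx.
Qed.

Lemma integ_act v g h phi : isAut g h -> finsupp v ->
  integ (fun c => v (map_tuple h c)) phi = integ v (phi \o map_tuple g).
Proof.
move=> aut fv; have [gh [hg _]] := aut.
rewrite (@integE _ (map (map_tuple g) (supp v)) _ (finsupp_act aut fv)).
- by rewrite big_map; apply: eq_bigr => c _; rewrite /= (map_tupleK gh).
- by rewrite (map_inj_uniq (can_inj (map_tupleK gh))) supp_uniq.
- move=> x /(mem_supp fv) xs.
  by rewrite -[x](map_tupleK hg); apply: map_f.
Qed.

Lemma tp_aut k g h (b : k.-tuple T) : isAut g h -> tp (map_tuple g b) = tp b.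
Proof.
move=> [_ [_ [gu [gb gl]]]]; apply/tpP.
by split=> [i u|i j c|i j]; rewrite !tnth_map.
Qed.

Lemma isAut_sym g h : isAut g h -> isAut h g.
Proof.
move=> [gh [hg [gu [gb gl]]]]; split=> //; split=> //.
split; [|split] => [x u|x y b|x y].
- by rewrite -gu hg.
- by rewrite -gb !hg.
- by rewrite -gl !hg.
Qed.

Definition comp_idx k := (tuple_type U B d * {ffun 'I_k -> 'I_d})%type.

Definition proj k (f : {ffun 'I_k -> 'I_d}) (c : d.-tuple T) : k.-tuple T :=
  [tuple tnth c (f i) | i < k].

(* The component (t, f) sums the coefficients of [v] over the tuples of type
   [t] whose subtuple selected by [f] is [b]. *)
Definition restr k (v : vect) (b : k.-tuple T) : 'rV[F]_#|{: comp_idx k}| :=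
  \row_x integ v (fun c =>
    ((tp c == (enum_val x).1) && (proj (enum_val x).2 c == b))%:R).

Lemma proj_map k (f : {ffun 'I_k -> 'I_d}) g c :
  proj f (map_tuple g c) = map_tuple g (proj f c).
Proof. by apply: eq_from_tnth => i; rewrite !(tnth_map, tnth_mktuple). Qed.

Lemma tp_proj k (f : {ffun 'I_k -> 'I_d}) (c c' : d.-tuple T) :
  tp c = tp c' -> tp (proj f c) = tp (proj f c').
Proof.
move=> /tpP[hu hb hl]; apply/tpP.
by split=> [i u|i j b|i j]; rewrite !tnth_mktuple.
Qed.

Lemma restrD k v w (b : k.-tuple T) : finsupp v -> finsupp w ->
  restr (fun c => v c + w c) b = restr v b + restr w b.
Proof. by move=> fv fw; apply/rowP => x; rewrite !mxE integD. Qed.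

Lemma restrZ k v a (b : k.-tuple T) : finsupp v ->
  restr (fun c => a * v c) b = a *: restr v b.
Proof. by move=> fv; apply/rowP => x; rewrite !mxE integZ. Qed.

Lemma restr_act k v g h (b : k.-tuple T) : isAut g h -> finsupp v ->
  restr (fun c => v (map_tuple h c)) b = restr v (map_tuple h b).
Proof.
move=> aut fv; apply/rowP => x; rewrite !mxE (integ_act _ aut fv).
apply: eq_integ => c /=; rewrite (tp_aut _ aut) proj_map.
have [gh [hg _]] := aut.
by rewrite (can2_eq (map_tupleK gh) (map_tupleK hg)).
Qed.

Definition projs k (v : vect) : seq (k.-tuple T) :=
  undup [seq proj f c | f <- enum {: {ffun 'I_k -> 'I_d}}, c <- supp v].

Lemma mem_projs k v (f : {ffun 'I_k -> 'I_d}) c :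
  c \in supp v -> proj f c \in projs k v.
Proof. by move=> cv; rewrite mem_undup; apply: allpairs_f; rewrite ?mem_enum. Qed.

Lemma restr_neq0 k v (b : k.-tuple T) : restr v b != 0 -> b \in projs k v.
Proof.
apply: contraR => nb; apply/eqP/rowP => x; rewrite !mxE /integ big_seq big1 // => c cv.
case: (eqVneq (proj _ c) b) => [e|]; last by rewrite andbF mul0r.
by rewrite -e mem_projs in nb.
Qed.

(** Grouping the tuples of type [t] by their projection b writes the pairing as a combination of
    components of [restr v b]. *)
Lemma integ_fiber k v t (f : {ffun 'I_k -> 'I_d}) phi :
  (forall c, tp c = t -> restr v (proj f c) = 0) ->
  integ v (fun c => (tp c == t)%:R * phi (proj f c)) = 0.
Proof.
move=> H; pose x := enum_rank ((t, f) : comp_idx k).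
transitivity (\sum_(b <- projs k v) phi b * integ v (fun c =>
    ((tp c == t) && (proj f c == b))%:R)).
  under [RHS]eq_bigr do rewrite mulr_sumr.
  rewrite exchange_big /integ !big_seq; apply: eq_bigr => c cv.
  rewrite (bigD1_seq (proj f c)) ?undup_uniq ?mem_projs //= eqxx andbT.
  rewrite big1 ?addr0 => [|b nb]; first by ring.
  by rewrite [proj f c == b]eq_sym (negPf nb) andbF mul0r mulr0.
(* The hypothesis covers only those b that are projections of a tuple of type [t]; for any other b
   the sum is empty. *)
apply: big1 => b _.
have [[c tc <-]|nex] := excluded_middle_informative (exists2 c, tp c = t & proj f c = b).
  by have /rowP /(_ x) := H c tc; rewrite !mxE enum_rankK /= => ->; rewrite mulr0.
rewrite integ_eq0 ?mulr0 // => c; case: andP => // -[/eqP tc /eqP pc].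
by case: nex; exists c.
Qed.

Definition orbit_chain k v (o : k.-tuple T) : seq ('rV[F]_#|{: comp_idx k}| * k.-tuple T) :=
  [seq (restr v b, b) | b <- projs k v & tp b == tp o].

Lemma orbit_chain_eval k v (o : k.-tuple T) t (f : {ffun 'I_k -> 'I_d}) phi :
  chain_eval (orbit_chain v o) phi 0 (enum_rank ((t, f) : comp_idx k)) =
  integ v (fun c => (tp c == t)%:R * ((tp (proj f c) == tp o)%:R * phi (proj f c))).
Proof.
rewrite /chain_eval big_map big_filter summxE big_mkcond /=.
transitivity (\sum_(b <- projs k v) ((tp b == tp o)%:R * phi b) * integ v (fun c =>
    ((tp c == t) && (proj f c == b))%:R)).
  apply: eq_bigr => b _; rewrite !mxE enum_rankK /=.
  by case: ifP => _; rewrite ?mul1r ?mul0r.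
under eq_bigr do rewrite mulr_sumr.
rewrite exchange_big /integ !big_seq; apply: eq_bigr => c cv.
rewrite (bigD1_seq (proj f c)) ?undup_uniq ?mem_projs //= eqxx andbT.
rewrite big1 ?addr0 => [|b nb]; first by ring.
by rewrite [proj f c == b]eq_sym (negPf nb) andbF mul0r mulr0.
Qed.

Lemma orbit_chain_eval_pt k v (o b : k.-tuple T) :
  chain_eval (orbit_chain v o) (fun b' => (b' == b)%:R) = if tp b == tp o then restr v b else 0.
Proof.
rewrite /chain_eval big_map big_filter /= big_mkcond /=.
have [e|ne] := eqVneq (tp b) (tp o); last first.
  apply: big1 => b' _; case: eqVneq => // e; case: eqVneq => [e'|]; last by rewrite scale0r.
  by rewrite -e' e eqxx in ne.
have [bp|bp] := boolP (b \in projs k v).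
  rewrite (bigD1_seq b) ?undup_uniq //= e !eqxx scale1r big1 ?addr0 // => b' /negPf->.
  by rewrite scale0r; case: ifP.
rewrite big_seq big1.
  by case: (eqVneq (restr v b) 0) => [->//|/restr_neq0]; rewrite (negPf bp).
move=> b' b'p; have -> : b' == b = false by apply: contraNF bp => /eqP <-.
by rewrite scale0r; case: ifP.
Qed.

(** Deleting entry i from a projection along [f] gives the projection along [f] composed with
    [lift i], an increasing tuple of smaller length, where [restr v] vanishes. *)
Lemma orbit_chain_faces l v (o : l.-tuple T) : incr lt o ->
  (forall k, (k < l)%N -> forall b : k.-tuple T, incr lt b -> restr v b = 0) ->
  forall (i : 'I_l) phi, indep i phi -> chain_eval (orbit_chain v o) phi = 0.
Proof.
case: l o => [|l] o io low i phi ip; first by case: i ip.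
apply/rowP => x; rewrite -(enum_valK x); case: (enum_val x) => t f.
rewrite orbit_chain_eval mxE.
have [[c0 tc0 pc0]|nex] :=
    excluded_middle_informative (exists2 c, tp c = t & tp (proj f c) = tp o); last first.
  apply: integ_eq0 => c; case: eqVneq => [tc|]; last by rewrite mul0r.
  case: eqVneq => [pc|]; last by rewrite mul0r mulr0.
  by case: nex; exists c.
pose f' := [ffun j => f (lift i j)] : {ffun 'I_l -> 'I_d}.
(* As [phi] ignores coordinate i, that slot may be filled by any point, here the one of [o]. *)
pose phi' (b : l.-tuple T) :=
  phi [tuple if unlift i j is Some j' then tnth b j' else tnth o i | j < l.+1].
rewrite -[RHS](@integ_fiber l v t f' phi') => [|c tc].
  apply: eq_integ => c; case: eqVneq => [tc|]; last by rewrite !mul0r.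
  rewrite (tp_proj _ (etrans tc (esym tc0))) pc0 eqxx !mul1r; apply: ip => j ji.
  rewrite !tnth_mktuple; case: unliftP => [j' ->|e]; last by rewrite e eqxx in ji.
  by rewrite tnth_mktuple ffunE.
apply: low => // a b; rewrite !tnth_mktuple !ffunE.
have := incr_tp (etrans (tp_proj f (etrans tc (esym tc0))) pc0) io.
move=> /(_ (lift i a) (lift i b)); rewrite !tnth_mktuple => ->.
by rewrite !ltnNge /= leq_bump2.
Qed.

End Restriction.

(** * Automorphisms moving a tuple over the vertices of a cube *)

Section CubesInSubspace.
Variables (U B : finType) (Fam : fstr U B -> Prop).
Variables (T : countType) (un : T -> U -> bool) (bin : T -> T -> B -> bool)
  (lt : rel T).
Hypothesis irrFam : forall S, Fam S -> irreducible S.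
Hypothesis limT : fraisse_limit un bin lt Fam.
Local Notation tp := (tp un bin lt).
Local Notation isAut := (isAut un bin lt).


Section Twins.
Variables (l : nat) (b0 : l.-tuple T) (Z : seq T) (beta : 'I_l -> bool).
Hypotheses (incrb0 : incr lt b0) (b0Z : forall i, tnth b0 i \in Z).

Local Notation node := (seq_sub Z + 'I_l)%type.

(* The twin [inr i] behaves as [tnth b0 i], is unrelated to it, and lies just above
   or just below it according to [beta i]. *)
Definition twin_fold (n : node) : T :=
  match n with inl z => val z | inr i => tnth b0 i end.

(** The factor 3 leaves a free slot on either side of each old point, at offsets 0 and 2 around its
    own offset 1. *)
Definition twin_key (n : node) : nat :=
  match n with
  | inl z => (3 * below lt Z (val z)).+1
  | inr i => 3 * below lt Z (tnth b0 i) + (if beta i then 2 else 0)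
  end.

Lemma twin_foldZ n : twin_fold n \in Z.
Proof. by case: n => [z|i] /=; [apply: valP|apply: b0Z]. Qed.

Lemma twin_key_lt n m : twin_fold n != twin_fold m ->
  (twin_key n < twin_key m)%N = lt (twin_fold n) (twin_fold m).
Proof.
move=> nm; rewrite -(below_lt limT (twin_foldZ n) (twin_foldZ m)).
have : below lt Z (twin_fold n) != below lt Z (twin_fold m).
  by apply: contra_neq nm => /(below_inj limT); apply; apply: twin_foldZ.
by case: n m {nm} => [z|i] [y|j] /= nm; repeat case: ifP => _; lia.
Qed.

Lemma twin_key_inj : injective twin_key.
Proof.
move=> n m e; have [en|nm] := eqVneq (twin_fold n) (twin_fold m); last first.
  have mn : twin_fold m != twin_fold n by rewrite eq_sym.
  by have := lt_total limT nm; rewrite -(twin_key_lt nm) -(twin_key_lt mn) e ltnn.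
case: n m e en => [z|i] [y|j] /=.
- by move=> _ /val_inj ->.
- by move=> e ez; move: e; rewrite ez; case: ifP; lia.
- by move=> e ez; move: e; rewrite ez; case: ifP; lia.
- by move=> _ /(incr_inj limT incrb0) ->.
Qed.

Lemma twins : exists e : node -> T, [/\ forall z, e (inl z) = val z, injective e,
    forall n u, un (e n) u = un (twin_fold n) u,
    forall n m b, bin (e n) (e m) b = bin (twin_fold n) (twin_fold m) b &
    forall n m, lt (e n) (e m) = (twin_key n < twin_key m)%N].
Proof.
apply: (extension limT (strict_total_key twin_key_inj)) => //.
- by move=> n b; exact: (bin_irrefl limT).
- move=> S FS [f [injf [fu fb]]]; apply: (forbT limT FS).
  apply: (@embeds_fold _ _ _ _ _ _ _ limT _ _ (fun n => un (twin_fold n))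
    (fun n m => bin (twin_fold n) (twin_fold m)) f twin_fold (irrFam FS) _ fu fb) => //.
  by move=> n b; exact: (bin_irrefl limT).
- by move=> z y; rewrite -(below_lt limT (valP z) (valP y)) /= ltnS ltn_pmul2l.
Qed.

End Twins.

(* [g S] moves [b0] onto the vertex [mix S a a'] of the cube, and on [Z] the
   coordinate [j] of [S] only matters at the point [tnth b0 j]. *)
Lemma cube_automorphisms l (o b0 a a' : l.-tuple T) (Z : seq T) :
  incr lt o -> tp b0 = tp o -> valid_cube un bin lt o setT (a, a') ->
  (forall i, tnth b0 i \in Z) ->
  exists g h : {set 'I_l} -> T -> T, [/\ forall S, isAut (g S) (h S),
    forall S, map_tuple (g S) b0 = mix S a a' &
    forall (S : {set 'I_l}) j z, z \in Z -> z != tnth b0 j -> g (j |: S) z = g (S :\ j) z].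
Proof.
move=> io tb0 [/= v1 v2] b0Z.
have ib0 := incr_tp tb0 io.
pose beta i := lt (tnth a i) (tnth a' i).
have [e [ei einj eu eb el]] := twins beta ib0 b0Z.
pose X (p : 'I_l * bool) := if p.2 then e (inr p.1) else tnth b0 p.1.
pose nX (p : 'I_l * bool) : seq_sub Z + 'I_l :=
  if p.2 then inr p.1 else inl (SeqSub (b0Z p.1)).
have XE p : X p = e (nX p) by rewrite /X /nX; case: p.2; rewrite ?ei.
have fX p : twin_fold b0 (nX p) = tnth b0 p.1 by rewrite /nX; case: p.2.
pose Y (p : 'I_l * bool) := if p.2 then tnth a' p.1 else tnth a p.1.
have Yu p u : un (Y p) u = un (tnth o p.1) u.
  have /tpP[/(_ p.1 u) + _ _] := v1 [set i | (i == p.1) && p.2] (subsetT _).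
  by rewrite tnth_mktuple inE eqxx.
(* Points of the cube at different coordinates lie on a common vertex, so validity determines their
   relations and order. *)
have YO p q : p.1 != q.1 ->
    (forall b, bin (Y p) (Y q) b = bin (tnth o p.1) (tnth o q.1) b) /\
    lt (Y p) (Y q) = lt (tnth o p.1) (tnth o q.1).
  move=> pq; have /tpP[_ hb hl] :=
    v1 [set i | (i == p.1) && p.2 || (i == q.1) && q.2] (subsetT _).
  have Yp : tnth (mix [set i | (i == p.1) && p.2 || (i == q.1) && q.2] a a') p.1 = Y p.
    by rewrite tnth_mktuple inE eqxx (negPf pq) orbF.
  have Yq : tnth (mix [set i | (i == p.1) && p.2 || (i == q.1) && q.2] a a') q.1 = Y q.
    by rewrite tnth_mktuple inE eqxx eq_sym (negPf pq).
  by split=> [b|]; rewrite -?hb -?hl Yp Yq.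
have Xinj : injective X.
  move=> p q; rewrite !XE => /einj; rewrite /nX.
  case: p q => [i [|]] [j [|]] //= [] => [->//|/(incr_inj limT ib0)->//].
(* [h0] takes [b0] to [a] and its twins to [a']. At equal coordinates both pairs are unrelated, and
   [beta] was chosen to give them the same order. *)
have [|||h0 [h0' [auth0 hX]]] := @homogeneous_fin _ _ Fam _ un bin lt limT _ X Y Xinj.
- move=> p u; rewrite Yu XE eu fX; by case/tpP: tb0.
- move=> p q b; rewrite !XE eb !fX; case/tpP: tb0 => _ -> _.
  have [epq|npq] := eqVneq p.1 q.1; last by case: (YO p q npq).
  have [_ h1 h2] := v2 q.1 (in_setT _).
  by rewrite /Y epq (bin_irrefl limT); case: p.2; case: q.2; rewrite ?(bin_irrefl limT).
- move=> p q; rewrite !XE el.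
  have [epq|npq] := eqVneq p.1 q.1; last first.
    rewrite twin_key_lt // !fX; last first.
      by apply: contra_neq npq => /(incr_inj limT ib0).
    by case: (YO p q npq) => _ ->; case/tpP: tb0 => _ _ ->.
  have [h0 _ _] := v2 q.1 (in_setT _).
  rewrite /Y /nX epq; case: p.2; case: q.2 => /=; rewrite ?(ltxx limT) ?ltnn //.
  - rewrite /beta; have := lt_total limT h0.
    case: ifP => [/(lt_asym limT)->|_ /= ->]; lia.
  - by rewrite /beta; case: ifP; lia.
(* [g S] is found by homogeneity: on [Z] it replaces the points of [b0] with index in [S] by their
   twins and then applies [h0]. *)
pose nu (S : {set 'I_l}) (z : seq_sub Z) : seq_sub Z + 'I_l :=
  if [pick j | (j \in S) && (tnth b0 j == val z)] is Some j then inr j else inl z.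
have fnu S z : twin_fold b0 (nu S z) = val z.
  by rewrite /nu; case: pickP => //= j /andP[_ /eqP].
have /fin_all_exists[gh Hgh] : forall S : {set 'I_l}, exists p : (T -> T) * (T -> T),
    isAut p.1 p.2 /\ forall z : seq_sub Z, p.1 (val z) = h0 (e (nu S z)).
  move=> S; have [hh [_ [hu [hb hl]]]] := auth0.
  have [||||g [h [aut Hg]]] := @homogeneous_fin _ _ Fam _ un bin lt limT (seq_sub Z)
      val (fun z => h0 (e (nu S z))).
  - exact: val_inj.
  - by move=> z u; rewrite hu eu fnu.
  - by move=> z y b; rewrite hb eb !fnu.
  - move=> z y; rewrite hl el; have [->|zy] := eqVneq z y; first by rewrite ltnn (ltxx limT).
    by rewrite twin_key_lt // !fnu.
  by exists (g, h).
exists (fun S => (gh S).1), (fun S => (gh S).2); split.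
- by move=> S; case: (Hgh S).
- move=> S; apply: eq_from_tnth => i; rewrite tnth_map tnth_mktuple.
  have [_ H] := Hgh S; rewrite -[tnth b0 i]/(val (SeqSub (b0Z i))) H.
  have -> : e (nu S (SeqSub (b0Z i))) = X (i, i \in S).
    rewrite XE /nX /= /nu; case: pickP => [j /andP[jS /eqP /= /(incr_inj limT ib0) ji]|].
      by rewrite -ji jS.
    by move=> /(_ i) /=; rewrite eqxx andbT => ->.
  by rewrite hX /Y /=.
- move=> S j z zZ zj; rewrite -[z]/(val (SeqSub zZ)).
  rewrite (Hgh (j |: S)).2 (Hgh (S :\ j)).2; congr (h0 (e _)); rewrite /nu.
  congr (if _ is Some j then inr j else _); apply: eq_pick => i /=; rewrite !inE.
  by case: eqVneq => //= ->; rewrite [_ == z]eq_sym (negPf zj).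
Qed.

End CubesInSubspace.

(** * Correcting by elements of the subspace, level by level *)

Section Levels.
Variables (U B : finType) (Fam : fstr U B -> Prop).
Variables (T : countType) (un : T -> U -> bool) (bin : T -> T -> B -> bool)
  (lt : rel T).
Hypothesis irrFam : forall S, Fam S -> irreducible S.
Hypothesis limT : fraisse_limit un bin lt Fam.
Local Notation tp := (tp un bin lt).
Local Notation isAut := (isAut un bin lt).
Variables (F : fieldType) (d : nat).
Local Notation vect := (d.-tuple T -> F).
Local Notation restr := (restr un bin lt).

Lemma incrP k (b : k.-tuple T) : incr lt b <-> sorted lt b.
Proof.
case E : (val b) => [|x0 s].
  split=> // _ i; have := ltn_ord i; have := size_tuple b; rewrite E /=; lia.
rewrite -E (sorted_pairwise (lt_trans limT)).
split=> [ib|/(pairwiseP x0) H i j].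
  apply/(pairwiseP x0) => i j; rewrite !inE size_tuple => ik jk ij.
  by have := ib (Ordinal ik) (Ordinal jk); rewrite !(tnth_nth x0) /= ij.
have H' (i' j' : 'I_k) : (i' < j')%N -> lt (tnth b i') (tnth b j').
  by move=> ij; rewrite !(tnth_nth x0); apply: H; rewrite // inE size_tuple.
have [/H'//|/H'|/val_inj ->] := ltngtP i j; last by rewrite (ltxx limT).
exact: lt_asym limT _ _.
Qed.

Lemma incr_subset k l (b1 : k.-tuple T) (b0 : l.-tuple T) : incr lt b1 -> incr lt b0 ->
  (k <= l)%N -> (forall j, tnth b0 j \in b1) -> val b0 = val b1.
Proof.
move=> /incrP s1 /incrP s0 kl sub.
have irr : irreflexive lt by move=> x; apply: ltxx limT _.
have u0 := sorted_uniq (lt_trans limT) irr s0.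
apply: (irr_sorted_eq (lt_trans limT) irr s0 s1).
have sub' : {subset val b0 <= val b1} by move=> x /tnthP[j ->].
by case: (uniq_min_size u0 sub' _); rewrite ?size_tuple.
Qed.

Lemma transitive_incr k (a b : k.-tuple T) : incr lt a -> tp b = tp a ->
  exists g h, isAut g h /\ b = map_tuple g a.
Proof.
move=> ia /tpP[hu hb hl].
have [g [h [aut H]]] := homogeneous limT (incr_inj limT ia) hu hb hl.
by exists g, h; split=> //; apply: eq_from_tnth => i; rewrite tnth_map H.
Qed.

Variable W : vect -> Prop.
Hypothesis invW : inv_subspace un bin lt W.

Lemma subspace_finsupp v : W v -> finsupp v. Proof. by case: invW => H _; apply: H. Qed.
Lemma subspace0 : W (fun _ => 0). Proof. by case: invW => _ []. Qed.
Lemma subspaceD v w : W v -> W w -> W (fun c => v c + w c).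
Proof. by case: invW => _ [_ [H _]]; apply: H. Qed.
Lemma subspaceZ x v : W v -> W (fun c => x * v c).
Proof. by case: invW => _ [_ [_ [H _]]]; apply: H. Qed.
Lemma subspace_act g h v : isAut g h -> W v -> W (fun c => v (map_tuple h c)).
Proof. by case: invW => _ [_ [_ [_ H]]] aut; apply: (H g h). Qed.

Lemma subspace_sum (I : Type) (r : seq I) (w : I -> vect) :
  (forall i, W (w i)) -> W (fun c => \sum_(i <- r) w i c).
Proof.
move=> Ww; elim: r => [|i r IHr].
  have -> : (fun c => \sum_(i <- [::]) w i c) = (fun _ => 0); last exact: subspace0.
  by apply: functional_extensionality => c; rewrite big_nil.
have -> : (fun c => \sum_(j <- i :: r) w j c) =
    (fun c => w i c + \sum_(j <- r) w j c); last exact: subspaceD.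
by apply: functional_extensionality => c; rewrite big_cons.
Qed.

Lemma integ_sum (I : Type) (r : seq I) (w : I -> vect) phi : (forall i, W (w i)) ->
  integ (fun c => \sum_(i <- r) w i c) phi = \sum_(i <- r) integ (w i) phi.
Proof.
move=> Ww; elim: r => [|i r IHr].
  rewrite big_nil (@integE _ _ _ _ [::]) ?big_nil //.
    by apply: subspace_finsupp; apply: subspace_sum.
  by move=> x; rewrite big_nil eqxx.
rewrite big_cons -IHr -integD; [|exact: subspace_finsupp|by apply: subspace_finsupp; apply: subspace_sum].
by congr integ; apply: functional_extensionality => c; rewrite big_cons.
Qed.

(** The terms of [S] and [j |: S] carry opposite signs and cancel. *)
Lemma alternating_eq0 l (j : 'I_l) (G : {set 'I_l} -> F) :
  (forall S : {set 'I_l}, G (j |: S) = G (S :\ j)) ->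
  \sum_(S : {set 'I_l} | S \subset [set: 'I_l]) (-1) ^+ #|S| * G S = 0.
Proof.
move=> H; rewrite (sum_subsetD1 _ (in_setT j)) big1 // => S.
rewrite subsetD1 => /andP[_ jS].
have -> : G (j |: S) = G S by rewrite H; congr G; apply/setDidPl; rewrite disjoint_sym disjoints1.
by rewrite cardsU1 jS exprS; ring.
Qed.

Definition lower_zero l (w : vect) :=
  forall k, (k < l)%N -> forall b : k.-tuple T, incr lt b -> restr w b = 0.

(* Replace [w] by its alternating sum over the vertices of the cube: a tuple of
   length at most [l] missing some point of [b0] cancels, so only [b0] is left. *)
Lemma cube_in_subspace l (o b0 a a' : l.-tuple T) w : incr lt o -> tp b0 = tp o ->
  valid_cube un bin lt o setT (a, a') -> W w ->
  exists2 w', W w' & lower_zero l w' /\ forall b : l.-tuple T, incr lt b ->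
    restr w' b = cube setT (a, a') (fun b' => (b' == b)%:R) *: restr w b0.
Proof.
move=> io tb0 va Ww.
have ib0 := incr_tp tb0 io; have fw := subspace_finsupp Ww.
pose Z : seq T := val b0 ++ flatten [seq val c | c <- supp w].
have b0Z i : tnth b0 i \in Z by rewrite mem_cat mem_tnth.
have cZ c i : c \in supp w -> tnth c i \in Z.
  move=> cw; rewrite mem_cat; apply/orP; right; apply/flattenP.
  by exists (val c); [apply: map_f|apply: mem_tnth].
have [g [h [aut gb0 gj]]] := cube_automorphisms irrFam limT io tb0 va b0Z.
pose wS (S : {set 'I_l}) : vect := fun c => (-1) ^+ #|S| * w (map_tuple (h S) c).
have WwS S : W (wS S) by apply: subspaceZ; apply: subspace_act (aut S) Ww.
pose w' : vect := fun c => \sum_(S : {set 'I_l}) wS S c.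
have integ_w' k (b : k.-tuple T) t (f : {ffun 'I_k -> 'I_d}) :
    integ w' (fun c => ((tp c == t) && (proj f c == b))%:R) =
    \sum_(c <- supp w) (tp c == t)%:R * w c *
      \sum_(S : {set 'I_l} | S \subset [set: 'I_l])
        (-1) ^+ #|S| * (map_tuple (g S) (proj f c) == b)%:R.
  rewrite integ_sum //.
  transitivity (\sum_(S : {set 'I_l}) \sum_(c <- supp w) (-1) ^+ #|S| *
      (((tp c == t) && (map_tuple (g S) (proj f c) == b))%:R * w c)).
    apply: eq_bigr => S _; rewrite integZ; last exact: finsupp_act (aut S) fw.
    rewrite (integ_act _ (aut S) fw) /integ mulr_sumr; apply: eq_bigr => c _ /=.
    by rewrite (tp_aut _ (aut S)) proj_map.
  rewrite exchange_big; apply: eq_bigr => c _; rewrite mulr_sumr.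
  rewrite (eq_bigl (fun S : {set 'I_l} => S \subset [set: 'I_l])); last first.
    by move=> S; rewrite subsetT.
  by apply: eq_bigr => S _; case: (tp c == t); case: eqP => _ /=; ring.
have inner k (b : k.-tuple T) (f : {ffun 'I_k -> 'I_d}) c : (k <= l)%N -> incr lt b ->
    c \in supp w -> val (proj f c) <> val b0 ->
    \sum_(S : {set 'I_l} | S \subset [set: 'I_l])
        (-1) ^+ #|S| * (map_tuple (g S) (proj f c) == b)%:R = 0 :> F.
  move=> kl ib cw ne.
  have pZ i : tnth (proj f c) i \in Z by rewrite tnth_mktuple; apply: cZ.
  (* Automorphisms preserve the order, so a projection that is not increasing is never sent to
     [b]. *)
  have [ip|nip] := excluded_middle_informative (incr lt (proj f c)); last first.
    apply: big1 => S _; case: eqP => [e|]; last by rewrite mulr0.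
    by case: nip; apply: (incr_tp (esym (tp_aut (proj f c) (aut S)))); rewrite e.
  (* A projection containing all points of [b0] is [b0], being no longer than it; otherwise it
     misses some [tnth b0 j] and the sum cancels in direction j. *)
  have [/forallP sub|/forallPn[j jp]] := boolP [forall j, tnth b0 j \in proj f c].
    by case: ne; rewrite (incr_subset ip ib0).
  apply: (alternating_eq0 (j := j)) => S; congr (_ == _)%:R.
  apply: eq_from_tnth => i; rewrite [LHS]tnth_map [RHS]tnth_map; apply: (gj S j _ (pZ i)).
  apply/eqP => e; case/negP: jp; rewrite -e; exact: mem_tnth.
exists w'; first exact: subspace_sum.
split=> [k kl b ib|b ib]; apply/rowP => x; rewrite !mxE integ_w'.
  rewrite big_seq big1 // => c cw; rewrite inner ?mulr0 ?(ltnW kl) // => e.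
  by move: kl; rewrite -(size_tuple (proj (enum_val x).2 c)) e size_tuple ltnn.
rewrite /integ mulr_sumr !big_seq; apply: eq_bigr => c cw.
have [e|ne] := eqVneq (proj (enum_val x).2 c) b0.
  rewrite e andbT /cube mulrC; congr (_ * _); apply: eq_bigr => S _.
  by rewrite gb0.
rewrite andbF mul0r mulr0 inner ?mulr0 // => e.
by case/eqP: ne; apply: val_inj.
Qed.

Lemma restr0 k (b : k.-tuple T) : restr (fun _ : d.-tuple T => 0 : F) b = 0.
Proof.
apply/rowP => x; rewrite !mxE (@integE _ _ _ _ [::]) ?big_nil //; first exact: finsupp0.
by move=> c; rewrite eqxx.
Qed.

Lemma cubes_in_subspace l (o : l.-tuple T) m : incr lt o ->
  (forall x, x \in m -> valid_cube un bin lt o setT x.2 /\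
     exists w b1, [/\ W w, tp b1 = tp o & restr w b1 = x.1]) ->
  exists2 w, W w & lower_zero l w /\ forall b : l.-tuple T, incr lt b ->
    restr w b = cubes_eval setT m (fun b' => (b' == b)%:R).
Proof.
move=> io; elim: m => [|[e [a a']] m IHm] Hm.
  exists (fun _ => 0); first exact: subspace0.
  by split=> [k _ b _|b _]; rewrite restr0 // /cubes_eval big_nil.
have [|w1 Ww1 [low1 eq1]] := IHm.
  by move=> x xm; apply: Hm; rewrite inE xm orbT.
have [va [w [b1 [Ww tb1 ew]]]] := Hm _ (mem_head _ _).
have [w2 Ww2 [low2 eq2]] := cube_in_subspace io tb1 va Ww.
exists (fun c => w2 c + w1 c); first exact: subspaceD.
split=> [k kl b ib|b ib]; rewrite restrD; try exact: subspace_finsupp.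
  by rewrite low1 // low2 // addr0.
by rewrite eq1 // eq2 // /cubes_eval big_cons ew.
Qed.

(** On each orbit [orbit_chain_faces] gives the zero sums that [span_cubes] needs; the resulting
    cubes have values of [W] as coefficients, so [cubes_in_subspace] realises them in [W]. *)
Lemma level_step l (v : vect) : finsupp v -> lower_zero l v ->
  (forall b : l.-tuple T, incr lt b ->
     exists w b1, [/\ W w, tp b1 = tp b & restr w b1 = restr v b]) ->
  exists2 w, W w & lower_zero l w /\
    forall b : l.-tuple T, incr lt b -> restr w b = restr v b.
Proof.
move=> fv low HE.
(* Types are added one at a time: the cubes used for one orbit have all vertices in it and leave the
   other orbits of length l unchanged. *)
have H (P : seq (tuple_type U B l)) : uniq P -> exists2 w, W w & lower_zero l w /\
    forall b : l.-tuple T, incr lt b -> restr w b = if tp b \in P then restr v b else 0.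
  elim: P => [_|p P IHP /= /andP[pP /IHP[w Ww [loww eqw]]]].
    by exists (fun _ => 0); [exact: subspace0|split=> [k _ b _|b _]; rewrite restr0].
  have [[o io to]|no] :=
      excluded_middle_informative (exists2 o : l.-tuple T, incr lt o & tp o = p); last first.
    exists w => //; split=> // b ib; rewrite eqw // inE.
    by case: eqVneq => //= e; case: no; exists b.
  pose E (e : 'rV[F]_#|{: comp_idx U B d l}|) :=
    exists w b1, [/\ W w, tp b1 = tp o & restr w b1 = e].
  have [x||m [mv meq]] := @span_cubes _ _ _ _ _ _ _ irrFam limT F _ l o io setT E
      (orbit_chain un bin lt v o).
  - move=> /mapP[b]; rewrite mem_filter => /andP[/eqP tb _] -> /=; split=> //.
    have [w1 [b1 [? tb1 ?]]] := HE b (incr_tp tb io).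
    by exists w1, b1; split=> //; rewrite tb1.
  - by move=> i _ phi ip; apply: orbit_chain_faces ip.
  have [w2 Ww2 [loww2 eqw2]] := cubes_in_subspace io mv.
  exists (fun c => w c + w2 c); first exact: subspaceD.
  split=> [k kl b ib|b ib]; rewrite restrD; try exact: subspace_finsupp.
    by rewrite loww // loww2 // addr0.
  rewrite eqw // eqw2 // -meq orbit_chain_eval_pt inE to.
  by case: eqVneq => [->|_]; rewrite ?(negPf pP) /= ?add0r ?addr0.
have [w Ww [loww eqw]] := H (enum {: tuple_type U B l}) (enum_uniq _).
by exists w => //; split=> // b ib; rewrite eqw // mem_enum.
Qed.

Definition orbit_values k (t : tuple_type U B k) (e : 'rV[F]_#|{: comp_idx U B d k}|) :=
  exists w b, [/\ W w, tp b = t & restr w b = e].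

(** Two values may be attained at different tuples of the orbit; translating one of the vectors by
    an automorphism lets both be read at the same tuple. *)
Lemma orbit_values_subspace k (a : k.-tuple T) : incr lt a ->
  is_subspace (orbit_values (tp a)).
Proof.
move=> ia; split; last split.
- by exists (fun _ => 0), a; split; rewrite ?restr0 //; apply: subspace0.
- move=> e1 e2 [w1 [b1 [Ww1 t1 <-]]] [w2 [b2 [Ww2 t2 <-]]].
  have [g [h [aut ->]]] := transitive_incr (incr_tp t1 ia) (etrans t2 (esym t1)).
  exists (fun c => w1 c + w2 (map_tuple g c)), b1; split=> //.
    by apply: subspaceD => //; apply: subspace_act (isAut_sym aut) Ww2.
  rewrite restrD; first by rewrite (restr_act _ (isAut_sym aut)) //; apply: subspace_finsupp.
    exact: subspace_finsupp.
  by apply: subspace_finsupp; apply: subspace_act (isAut_sym aut) Ww2.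
- move=> x e [w [b [Ww tb <-]]]; exists (fun c => x * w c), b.
  by split=> //; [apply: subspaceZ|rewrite restrZ //; apply: subspace_finsupp].
Qed.

(** Let b list the distinct entries of c in increasing order and let f select them from c. Then c is
    the only tuple of its type projecting to b, so v c is the component ([tp c], f) of
    [restr v b]. *)
Lemma restr_separates (v : vect) : finsupp v ->
  (forall k, (k <= d)%N -> forall b : k.-tuple T, incr lt b -> restr v b = 0) ->
  forall c, v c = 0.
Proof.
move=> fv low c; pose s := sort (fun x y => (x == y) || lt x y) (undup c).
have total_le : total (fun x y => (x == y) || lt x y).
  move=> x y; have [->|] := eqVneq x y; first by [].
  by move=> /(lt_total limT) /orP[]->; rewrite ?orbT.
have us : uniq s by rewrite sort_uniq undup_uniq.
have ss : sorted lt s.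
  have := sort_sorted total_le (undup c); rewrite -/s.
  rewrite !sorted_pairwise; [|exact: lt_trans limT|]; last first.
    move=> y x z /orP[/eqP->//|xy] /orP[/eqP<-|yz]; first by rewrite xy orbT.
    by rewrite (lt_trans limT xy yz) orbT.
  move: us; rewrite uniq_pairwise => us le_s.
  have := conj us le_s; move/andP; rewrite -pairwise_relI.
  by apply: sub_pairwise => x y /= /andP[/negPf-> ].
pose b := in_tuple s.
have ms i : tnth c i \in s by rewrite mem_sort mem_undup mem_tnth.
have sd : (size s <= d)%N by rewrite size_sort -{2}(size_tuple c) size_undup.
have [f ef] : exists f : {ffun 'I_(size s) -> 'I_d}, forall i, tnth c (f i) = tnth b i.
  have /fin_all_exists[f Hf] : forall i : 'I_(size s), exists j, tnth c j = tnth b i.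
    move=> i; have : tnth b i \in c by rewrite -mem_undup -(mem_sort (fun x y => (x == y) || lt x y)) mem_tnth.
    by move=> /tnthP[j ->]; exists j.
  by exists (finfun f) => i; rewrite ffunE.
have [r er] : exists r : 'I_d -> 'I_(size s), forall i, tnth c i = tnth b (r i).
  have /fin_all_exists[r Hr] : forall i : 'I_d, exists j, tnth c i = tnth b j.
    by move=> i; have /tnthP[j ->] : tnth c i \in b := ms i; exists j.
  by exists r.
have /rowP /(_ (enum_rank ((tp c, f) : comp_idx U B d (size s)))) :=
  low _ sd b ((incrP b).2 ss).
rewrite !mxE enum_rankK /= => <-.
have uniq_c c' : (tp c' == tp c) && (proj f c' == b) = (c' == c).
  apply/andP/eqP => [[/eqP tc /eqP pc]|->]; last first.
    by split=> //; apply/eqP/eq_from_tnth => i; rewrite tnth_mktuple ef.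
  have pc' j : tnth c' (f j) = tnth b j by rewrite -pc tnth_mktuple.
  apply: eq_from_tnth => i; rewrite er -pc'; apply/eqP; apply: contraTT isT.
  move=> /(lt_total limT); case/tpP: tc => _ _ hl.
  by rewrite !hl ef -er (ltxx limT).
rewrite (@eq_integ _ _ _ _ _ (fun c' => (c' == c)%:R)); last first.
  by move=> c'; rewrite uniq_c.
have [v0|vc] := eqVneq (v c) 0.
  rewrite /integ big1 // => c' _; case: eqVneq => [->|]; first by rewrite v0 mulr0.
  by rewrite mul0r.
rewrite /integ (bigD1_seq c) ?supp_uniq ?mem_supp //= eqxx mul1r big1 ?addr0 // => c' /negPf->.
by rewrite mul0r.
Qed.

Lemma in_subspace (v : vect) : finsupp v ->
  (forall k, (k <= d)%N -> forall b : k.-tuple T, incr lt b ->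
     orbit_values (tp b) (restr v b)) ->
  W v.
Proof.
move=> fv Hv.
(* Level d.+1 is reached so that the difference has zero [restr] at all lengths up to and including
   d. *)
have H n : (n <= d.+1)%N -> exists2 w, W w & lower_zero n (fun c => v c - w c).
  elim: n => [_|n IHn nd]; first by exists (fun _ => 0); [exact: subspace0|].
  have [w Ww low] := IHn (ltnW nd).
  have fw := subspace_finsupp Ww.
  have e_sub u : (fun c => v c - u c) = (fun c => v c + -1 * u c).
    by apply: functional_extensionality => c; rewrite mulN1r.
  have fN u : finsupp u -> finsupp (fun c : d.-tuple T => -1 * u c : F).
    exact: finsuppZ.
  have rB u k (b : k.-tuple T) : finsupp u ->
      restr (fun c => v c - u c) b = restr v b - restr u b.
    by move=> fu; rewrite e_sub restrD ?restrZ ?scaleN1r //; apply: fN.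
  have fvw : finsupp (fun c => v c - w c) by rewrite e_sub; apply: finsuppD => //; apply: fN.
  have [|w2 Ww2 [low2 eq2]] := level_step fvw low.
    move=> b ib; rewrite rB //.
    have [_ [Ea Es]] := orbit_values_subspace ib.
    apply: Ea; first exact: Hv.
    rewrite -scaleN1r; apply: Es; by exists w, b.
  exists (fun c => w c + w2 c) => [|k]; first exact: subspaceD.
  have fww : finsupp (fun c => w c + w2 c) by apply: subspace_finsupp; apply: subspaceD.
  rewrite ltnS leq_eqVlt => /orP[/eqP->|kn] b ib; rewrite rB // restrD //; try exact: subspace_finsupp.
    by rewrite eq2 // rB // subrKC subrr.
  by have := low k kn b ib; rewrite rB // low2 // addr0.
have [w Ww low] := H _ (leqnn _).
have -> : v = w; last by [].
apply: functional_extensionality => c; apply/eqP; rewrite -subr_eq0; apply/eqP.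
apply: (@restr_separates (fun c => v c - w c)); last by move=> k kd; apply: low.
have -> : (fun c => v c - w c) = (fun c => v c + -1 * w c).
  by apply: functional_extensionality => c'; rewrite mulN1r.
by apply: finsuppD => //; apply: finsuppZ; apply: subspace_finsupp.
Qed.

End Levels.

(** * Restriction to single orbits and assembly of the family *)

Lemma in_tuple_ind (T : Type) (P : forall k, k.-tuple T -> Prop) k (a : k.-tuple T) :
  P _ (in_tuple (val a)) -> P k a.
Proof.
case: a => s i; have e := eqP i; case: k / e i => i /=.
by have -> : Tuple i = in_tuple s by apply: val_inj.
Qed.

Section OrbitRestriction.
Variables (U B : finType) (Fam : fstr U B -> Prop).
Variables (T : countType) (un : T -> U -> bool) (bin : T -> T -> B -> bool)
  (lt : rel T).
Hypothesis limT : fraisse_limit un bin lt Fam.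
Local Notation tp := (tp un bin lt).
Variables (F : fieldType) (d : nat).

(** The cut-off by type makes the map vanish outside the orbit of [a], and stays equivariant since
    types are invariant. *)
Definition orbit_restr k (a : k.-tuple T) (v : d.-tuple T -> F) (b : k.-tuple T) :
    'rV[F]_#|{: comp_idx U B d k}| :=
  if tp b == tp a then restr un bin lt v b else 0.

Lemma in_aut_orbitP k (a b : k.-tuple T) : incr lt a ->
  in_aut_orbit un bin lt a b <-> tp b = tp a.
Proof.
move=> ia; split; last exact: (transitive_incr limT).
by move=> [g [h [aut ->]]]; apply: tp_aut aut.
Qed.

Lemma orbit_restr_linear k (a : k.-tuple T) : incr lt a ->
  equiv_linear un bin lt a (orbit_restr a).
Proof.
move=> ia; split; [|split; [|split]].
- move=> v fv; split=> [|b nb].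
    exists (projs k v) => b; rewrite /orbit_restr; case: ifP => _; last by rewrite eqxx.
    exact: restr_neq0.
  by rewrite /orbit_restr; case: eqP => // /(in_aut_orbitP _ ia).
- move=> v w fv fw b; rewrite /orbit_restr; case: ifP => _; first exact: restrD.
  by rewrite addr0.
- move=> x v fv b; rewrite /orbit_restr; case: ifP => _; first exact: restrZ.
  by rewrite scaler0.
- move=> g h aut v fv b; rewrite /orbit_restr (tp_aut _ (isAut_sym aut)).
  by case: ifP => // _; apply: restr_act aut fv.
Qed.

Variable W : (d.-tuple T -> F) -> Prop.

Lemma EsetP k (a : k.-tuple T) e : incr lt a ->
  Eset un bin lt W a (orbit_restr a) e <-> orbit_values un bin lt W (tp a) e.
Proof.
move=> ia; split=> [[w [b [Ww [/(in_aut_orbitP _ ia) tb <-]]]]|[w [b [Ww tb <-]]]].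
  by exists w, b; split=> //; rewrite /orbit_restr tb eqxx.
exists w, b; split=> //; split; first exact/(in_aut_orbitP _ ia).
by rewrite /orbit_restr tb eqxx.
Qed.

End OrbitRestriction.

Theorem mainTheorem15 (U B : finType) (Fam : fstr U B -> Prop)
  (T : countType) (un : T -> U -> bool) (bin : T -> T -> B -> bool) (lt : rel T)
  (F : fieldType) (d : nat) :
  (forall S, Fam S -> irreducible S) ->
  fraisse_limit un bin lt Fam ->
  (1 <= d)%N ->
  exists (k : nat) (dd nn : 'I_k -> nat) (a : forall i, (dd i).-tuple T)
         (rho : forall i, (d.-tuple T -> F) -> ((dd i).-tuple T -> 'rV[F]_(nn i))),
    (forall i, (dd i <= d)%N /\ (1 <= nn i)%N /\ increasing lt (a i) /\
               equiv_linear un bin lt (a i) (rho i)) /\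
    (forall W : (d.-tuple T -> F) -> Prop, inv_subspace un bin lt W ->
       (forall i, is_subspace (Eset un bin lt W (a i) (rho i))) /\
       (forall v, W v <->
          (finsupp v /\ forall i b, in_aut_orbit un bin lt (a i) b ->
                                    Eset un bin lt W (a i) (rho i) (rho i v b)))).
Proof.
move=> irrFam limT d_gt0.
(* The family is indexed by all types of length at most d, with an increasing representative for
   each realised one. *)
pose I := {k : 'I_d.+1 & tuple_type U B k}.
have /fin_all_exists[r Hr] : forall x : I, exists r : seq T,
    [/\ sorted lt r, (size r <= d)%N &
     forall b : (tag x).-tuple T, incr lt b -> tp un bin lt b = tagged x ->
       exists2 a : (tag x).-tuple T, val a = r & tp un bin lt a = tagged x].
  move=> x; have [[b ib tb]|nb] := excluded_middle_informative
      (exists2 b : (tag x).-tuple T, incr lt b & tp un bin lt b = tagged x).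
    exists (val b); split; [exact/(incrP limT)| |by exists b].
    by rewrite size_tuple -ltnS.
  (* A type with no increasing realisation gets the empty tuple, which merely repeats the orbit of
     length 0. *)
  by exists [::]; split=> // b ib tb; case: nb; exists b.
pose dd (i : 'I_#|{: I}|) := size (r (enum_val i)).
pose a i : (dd i).-tuple T := in_tuple (r (enum_val i)).
have ia i : incr lt (a i) by apply/(incrP limT); have [] := Hr (enum_val i).
exists #|{: I}|, dd, (fun i => #|{: comp_idx U B d (dd i)}|), a.
exists (fun i => orbit_restr un bin lt (a i)); split=> [i|W invW].
  split; first by have [] := Hr (enum_val i).
  split; last by split; [exact/(incrP limT)|exact: orbit_restr_linear limT _ _ _ _ (ia i)].
  (* The target has positive dimension because d is positive, so that a constant index map into
     ['I_d] exists. *)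
  apply/card_gt0P; exists ([ffun=> false], [ffun=> false], [ffun=> false], [ffun=> Ordinal d_gt0]).
  by [].
split=> [i|v].
  have [E0 [ED EZ]] := orbit_values_subspace limT invW (ia i).
  split; [|split] => [|e f|x e]; rewrite !(EsetP limT) //; [exact: ED|exact: EZ].
split=> [Wv|[fv Hv]].
  by split=> [|i b ob]; [exact: subspace_finsupp invW _ Wv|exists v, b].
apply: (in_subspace irrFam limT invW fv) => k kd b ib.
pose x : I := Tagged (fun k : 'I_d.+1 => tuple_type U B k)
  (tp un bin lt b : tuple_type U B (Ordinal (kd : (k < d.+1)%N))).
have [_ _ /(_ b ib erefl)[a' /= ea ta]] := Hr x.
(* The family stores representatives at length [size (r x)]; abstracting over the length transports
   the hypothesis to the k-tuple [a']. *)
pose P k' (a0 : k'.-tuple T) := forall b, in_aut_orbit un bin lt a0 b ->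
  Eset un bin lt W a0 (orbit_restr un bin lt a0) (orbit_restr un bin lt a0 v b).
have Pa : P k a'.
  apply: (@in_tuple_ind T P); have -> : val a' = r x := ea.
  by have := Hv (enum_rank x); rewrite /a /dd enum_rankK.
have ia' : incr lt a' := incr_tp ta ib.
have := Pa b ((in_aut_orbitP limT b ia').2 (esym ta)).
by rewrite (EsetP limT) // /orbit_restr ta eqxx.
Qed.
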